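(* For any integer $s\ge 3$ and any $r\in\{1,2\}$, there is a constant $C$ such that in the $r$-offer $s$-uniform semirandom model there exists a strategy with the following property: for $n$ divisible by $s-1$, the hypergraph $H_t$ obtained after $t=Cn$ rounds asymptotically almost surely (with probability tending to $1$ as $n\to\infty$) contains a loose Hamilton cycle.
   Context: The $r$-offer $s$-uniform semirandom model: a player builds a sequence of $s$-uniform hypergraphs $H_0, H_1, H_2, \ldots$ on vertex set $[n]=\{1,\ldots,n\}$, with $H_0$ empty. In each round $t\ge 1$, a uniformly random set of $r$ vertices of $[n]$ is offered; the player, knowing the offered vertices and the entire history (including $H_{t-1}$), chooses $s-r$ further vertices, and the resulting $s$-set is added as a hyperedge to $H_{t-1}$ to form $H_t$. (The player may also ignore an offer, which still counts as a round.) A strategy is a rule for these choices. A loose Hamilton cycle in an $s$-uniform hypergraph on $[n]$ ($n$ divisible by $s-1$) is a collection of $m=n/(s-1)$ hyperedges $e_1,\ldots,e_m$ such that for some cyclic ordering $v_1,\ldots,v_n$ of $[n]$, each $e_i$ consists of $s$ consecutive vertices $v_{(i-1)(s-1)+1},\ldots,v_{(i-1)(s-1)+s}$ (indices mod $n$); thus consecutive hyperedges share exactly one vertex and all vertices are covered. *)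

(* Defs.v *)
From mathcomp Require Import all_boot all_order all_fingroup all_algebra.
From mathcomp Require Import reals.

Set Implicit Arguments.
Unset Strict Implicit.
Unset Printing Implicit Defensive.

Import GRing.Theory.

Definition offer (r n : nat) : finType := {U : {set 'I_n} | #|U| == r}.

(* None encodes that the player ignores the offer. *)
Definition reply (n : nat) : finType := option {set 'I_n}.

Definition history (r n : nat) : Type := seq (offer r n * reply n).

Definition legal_reply (r s n : nat) (U : offer r n) (a : reply n) : bool :=
  if a is Some A then (#|A| == s - r) && [disjoint A & val U] else true.

(* The rounds of a history are listed from the first to the most recent. *)
Record strategy (r s n : nat) : Type := Strategy {
  respond :> history r n -> offer r n -> reply n;
  respond_legal :
    forall (h : history r n) (U : offer r n), legal_reply s U (respond h U)
}.

Definition play (r s n : nat) (sigma : strategy r s n) (us : seq (offer r n)) :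
    history r n :=
  foldl (fun h U => rcons h (U, sigma h U)) [::] us.

Definition add_round (r n : nat) (H : {set {set 'I_n}})
    (x : offer r n * reply n) : {set {set 'I_n}} :=
  if x.2 is Some A then (val x.1 :|: A) |: H else H.

Definition hypergraph (r n : nat) (h : history r n) : {set {set 'I_n}} :=
  foldl (@add_round r n) set0 h.

(* The i-th edge of the loose cycle along the cyclic ordering v; positions and
   edges are numbered from 0. *)
Definition loose_edge (s n : nat) (v : {perm 'I_n}) (i : nat) : {set 'I_n} :=
  [set v j | j : 'I_n & [exists k : 'I_s, j == (i * (s - 1) + k) %% n :> nat]].

Definition has_loose_Hamilton_cycle (s n : nat) (H : {set {set 'I_n}}) : bool :=
  [exists v : {perm 'I_n},
    [forall i : 'I_(n %/ (s - 1)), loose_edge s v i \in H]].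

Definition uniform_prob_of (R : realType) (T : finType) (E : pred T) : R :=
  (#|[set x | E x]|%:R / #|T|%:R)%R.

(* The offers of distinct rounds are independent and uniform, so the sequence
   of the first t offers is uniform. *)
Definition prob_loose_Hamilton (R : realType) (r s n : nat)
    (sigma : strategy r s n) (t : nat) : R :=
  uniform_prob_of R (fun us : t.-tuple (offer r n) =>
    has_loose_Hamilton_cycle s (hypergraph (play sigma us))).

(* Main.v *)
(* The player must find a loose cycle although some vertices are never offered.
   Put n = (s - 1) m.  A block of s - 3 padding vertices is attached to every
   edge, which leaves a 3-uniform problem on 2m vertices in which two vertices of
   an edge are random and one is chosen.  It suffices to bound the failure
   probability of an optimal player, defined by backward induction; in these
   terms one random vertex is no worse than two, since a choice can only improve
   on a random draw.

   In the first phase, hubs 0, ..., m - 4a are fixed, where a = m / 100, and every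
   offer consisting of a hub j and a later vertex x is completed by the hub j + 1.
   By a union bound, any a slots and any a later vertices then span an edge.
   After deleting a maximal non-expanding pair of small sets, the remaining slots
   and vertices satisfy Hall's condition robustly.  The deleted slots, and the
   deleted vertices inserted as further hubs, leave O(a) pairs of consecutive hubs
   (v, w) still to be joined, each by two edges {v, x, y} and {y, z, w}.

   In the second phase, {v, x, y} is built for many pairs (x, y) of reserve
   vertices (a mark of v), until an offer contains such a y.  When K links are
   missing, about sqrt(m / K) marks for each of them give success probability of
   order sqrt(K / m) per round, and the sum over K of the expected waiting times
   is O(m).  Each link uses up three reserve vertices, and the sizes are such that
   the slots that are left are exactly as many as the vertices that are left;
   Hall's theorem matches them and closes the cycle. *)

Require Import Defs.
From mathcomp Require Import all_boot all_order all_algebra.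
From mathcomp Require Import all_classical all_reals all_analysis.
From mathcomp Require Import ring lra zify.
From mathcomp Require Import perm finset.

Set Implicit Arguments.
Unset Strict Implicit.
Unset Printing Implicit Defensive.

Import Order.TTheory GRing.Theory Num.Theory.
Local Open Scope ring_scope.

(** * The value of the game *)

Section Game.
Variables (R : realType) (r s n : nat).
Notation graph := {set {set 'I_n}}.
Implicit Types (H : graph) (Q : graph -> Prop) (U : offer r n) (t : nat).

(* Probability that an optimal player, starting from [H], has not reached [Q]
   after [t] rounds: optimal replies depend only on [t], [H] and the offer. *)
Fixpoint fail Q t H : R :=
  if t is t'.+1 then
    (\sum_(U : offer r n)
       fail Q t' (add_round H (U, [arg min_(a < None | legal_reply s U a)
                                     fail Q t' (add_round H (U, a))]%O)))
      / #|offer r n|%:R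
  else (~~ `[< Q H >])%:R.

Definition best Q t H U : reply n :=
  [arg min_(a < None | legal_reply s U a) fail Q t (add_round H (U, a))]%O.

Lemma failS Q t H : fail Q t.+1 H =
  (\sum_(U : offer r n) fail Q t (add_round H (U, best Q t H U)))
    / #|offer r n|%:R.
Proof. by []. Qed.

Lemma best_legal Q t H U : legal_reply s U (best Q t H U).
Proof. by rewrite /best; case: arg_minP. Qed.

Lemma best_min Q t H U a : legal_reply s U a ->
  fail Q t (add_round H (U, best Q t H U)) <= fail Q t (add_round H (U, a)).
Proof. by rewrite /best; case: arg_minP => // b _ bmin la; apply: bmin. Qed.

Lemma fail_ge0 Q t H : 0 <= fail Q t H.
Proof.
elim: t H => [|t IH] H; first by rewrite /= ler0n.
by rewrite failS divr_ge0 ?ler0n // sumr_ge0.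
Qed.

Lemma fail_le_average Q t H (g : offer r n -> R) :
  (forall U, exists2 a, legal_reply s U a & fail Q t (add_round H (U, a)) <= g U) ->
  fail Q t.+1 H <= (\sum_U g U) / #|offer r n|%:R.
Proof.
move=> Hg; rewrite failS ler_wpM2r ?invr_ge0 ?ler0n // ler_sum // => U _.
by have [a la /(le_trans (best_min _ _ _ la))] := Hg U.
Qed.

(** In a game of [T] rounds, [(T - size h).-1] rounds remain once the current offer is answered; the
    reply is the one that defines [fail] at that horizon. *)
Lemma optimal_legal Q T (h : history r n) U :
  legal_reply s U (best Q (T - size h).-1 (hypergraph h) U).
Proof. exact: best_legal. Qed.

Definition optimal Q T : strategy r s n := Strategy (optimal_legal Q T).

Lemma hypergraph_rcons (h : history r n) x :
  hypergraph (rcons h x) = add_round (hypergraph h) x.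
Proof. by rewrite /hypergraph -cats1 foldl_cat. Qed.

Lemma sum_tupleS (T : finType) t (F : seq T -> R) :
  \sum_(us : t.+1.-tuple T) F us = \sum_U \sum_(us : t.-tuple T) F (U :: us).
Proof.
rewrite pair_big /=.
rewrite (reindex (fun p : T * t.-tuple T => [tuple of p.1 :: p.2])) //=.
exists (fun us : t.+1.-tuple T => (thead us, [tuple of behead us])).
  by case=> U us _; congr pair; apply: val_inj.
by move=> us _; case/tupleP: us => U us; apply: val_inj.
Qed.

(** Counting failing offer sequences avoids division; the arbitrary initial history [h] makes the
    induction on the remaining rounds go through. *)
Lemma sum_fail_play Q T t (h : history r n) :
  (0 < #|offer r n|)%N -> (t + size h = T)%N ->
  \sum_(us : t.-tuple (offer r n))
     (~~ `[< Q (hypergraph (foldl (fun h U => rcons h (U, optimal Q T h U)) h us)) >])%:R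
  = fail Q t (hypergraph h) * #|offer r n|%:R ^+ t.
Proof.
move=> N0; elim: t h => [|t IH] h hT.
  rewrite expr0 mulr1 (big_pred1 [tuple]) // => us; by rewrite [us]tuple0 /= eqxx.
rewrite (sum_tupleS _ (fun us => (~~ `[< Q (hypergraph
  (foldl (fun h U => rcons h (U, optimal Q T h U)) h us)) >])%:R)).
rewrite failS exprS mulrA divfK ?pnatr_eq0 -?lt0n // mulr_suml.
apply: eq_bigr => U _ /=; rewrite IH; last by rewrite size_rcons; lia.
rewrite hypergraph_rcons /best /=; congr (fail _ _ (add_round _ (_, _)) * _).
by have -> : (T - size h).-1 = t by lia.
Qed.

End Game.

Lemma prob_optimal (R : realType) r s n T : (0 < #|offer r n|)%N ->
  prob_loose_Hamilton R (optimal R r s (fun H : {set {set 'I_n}} => has_loose_Hamilton_cycle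
    s H) T) T
  = 1 - @fail R r s n (fun H => has_loose_Hamilton_cycle s H) T set0.
Proof.
move=> N0; have Nn : #|offer r n|%:R ^+ T != 0 :> R by rewrite expf_neq0 // pnatr_eq0 -lt0n.
have := @sum_fail_play R r s n (fun H => has_loose_Hamilton_cycle s H) T T [::] N0 (addn0 T).
move=> /(canLR (mulfK Nn)) <-.
rewrite /prob_loose_Hamilton /uniform_prob_of card_tuple natrX.
apply: (canRL (addrK _)); rewrite -mulrDl; apply: (canLR (mulfK Nn)).
rewrite mul1r -natrX -card_tuple.
set A := [set x | _].
rewrite -(cardsC A) natrD -[#|~: A|]sum1_card natr_sum.
congr (_ + _); rewrite [RHS]big_mkcond /=; apply: eq_bigr => us _.
by rewrite !inE /play asboolb; case: ifP.
Qed.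

(** * Potential arguments for the failure probability *)

Section Bounds.
Variables (R : realType) (r s n : nat).
Notation graph := {set {set 'I_n}}.
Notation fail := (@fail R r s n).
Implicit Types (H : graph) (Q : graph -> Prop) (U : offer r n) (t : nat).

Lemma average_le (g : offer r n -> R) (c : R) : 0 <= c ->
  (forall U, g U <= c) -> (\sum_U g U) / #|offer r n|%:R <= c.
Proof.
move=> c0 gc; have [N0|N0] := posnP #|offer r n|.
  by rewrite N0 invr0 mulr0.
rewrite ler_pdivrMr ?ltr0n // mulr_natr -sumr_const.
exact: ler_sum.
Qed.

(** Once [Q] holds, ignoring all offers keeps the graph unchanged. *)
Lemma fail_done Q t H : Q H -> fail Q t H <= 0.
Proof.
elim: t => [|t IH] QH /=; first by rewrite asboolT.
apply: le_trans (@fail_le_average R r s n Q t H (fun=> 0) _) _.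
  by move=> U; exists None => //; apply: IH.
exact: average_le.
Qed.

(** The player plays optimally for [Q1] during [t1] rounds and then for [Q]; the two failure bounds
    add. *)
Lemma fail_trans Q1 Q t1 t2 H (e2 : R) : 0 <= e2 ->
  (forall H', Q1 H' -> fail Q t2 H' <= e2) ->
  fail Q (t1 + t2) H <= fail Q1 t1 H + e2.
Proof.
move=> e20 H12; elim: t1 H => [|t1 IH] H.
  rewrite add0n /=; have [Q1H|nQ1] := asboolP (Q1 H); first by rewrite add0r H12.
  have fail_le1 t : fail Q t H <= 1; last by rewrite (le_trans (fail_le1 _)) // lerDl.
  elim: t H {nQ1} => [|t IH] H /=; first by rewrite lern1 leq_b1.
  exact: average_le.
rewrite addSn [X in _ <= X + _]failS.
apply: le_trans (fail_le_average
  (g := fun U => fail Q1 t1 (add_round H (U, best R s Q1 t1 H U)) + e2) _) _.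
  by move=> U; exists (best R s Q1 t1 H U); rewrite ?best_legal.
by rewrite big_split mulrDl /= lerD2l; apply: average_le.
Qed.

(** First-moment method: [Phi] dominates the indicator of failure and shrinks on average by the
    factor [q] in each round when the replies [rep] are used. *)
Lemma fail_contract Q (Phi : graph -> R) (q : R) t H :
  0 <= q -> (forall H, 0 <= Phi H) -> (forall H, ~ Q H -> 1 <= Phi H) ->
  (forall H, exists2 rep : offer r n -> reply n,
     forall U, legal_reply s U (rep U) &
     \sum_U Phi (add_round H (U, rep U)) <= q * Phi H * #|offer r n|%:R) ->
  fail Q t H <= q ^+ t * Phi H.
Proof.
move=> q0 Phi0 Phi1 step; elim: t H => [|t IH] H.
  rewrite expr0 mul1r /=; have [_|/Phi1//] := asboolP (Q H); exact: Phi0.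
have [rep legal_rep le_rep] := step H.
apply: le_trans (fail_le_average (g := fun U => q ^+ t * Phi (add_round H (U, rep U))) _) _.
  by move=> U; exists (rep U).
rewrite -mulr_sumr exprSr -!mulrA ler_wpM2l ?exprn_ge0 //.
have [N0|N0] := posnP #|offer r n|; first by rewrite N0 invr0 mulr0 mulr_ge0.
by rewrite ler_pdivrMr ?ltr0n.
Qed.

Lemma expRN_le (y : R) : 0 <= y <= 1 -> expR (- y) <= 1 - y / 2.
Proof.
move=> /andP[y0 y1]; rewrite expRN.
apply: (@le_trans _ _ (1 + y)^-1).
  by rewrite lef_pV2 ?posrE ?expR_gt0 ?expR_ge1Dx //; lra.
rewrite -[leLHS]mul1r ler_pdivrMr ?(lt_le_trans ltr01) ?lerDl //.
have : 0 <= y * (1 - y) by rewrite mulr_ge0 // subr_ge0.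
have -> : (1 - y / 2) * (1 + y) = 1 + y * (1 - y) / 2 by field.
lra.
Qed.

(* In a state of weight [w] a proportion at least [p] of the offers decreases
   the weight by [1 / p], so [w] is the expected remaining time; the potential
   [exp (pmin * w)] then contracts by the factor [1 - pmin / 2] per round. *)
Lemma fail_drift Q (St : R -> graph -> Prop) (pmin : R) :
  0 < pmin -> (0 < #|offer r n|)%N ->
  (forall w H, St w H -> 0 <= w) ->
  (forall w H, St w H -> Q H \/ exists p, exists A : {set offer r n},
     [/\ pmin <= p, p * #|offer r n|%:R <= #|A|%:R &
      forall U, U \in A -> exists2 a, legal_reply s U a &
        exists2 w', St w' (add_round H (U, a)) & w' <= w - p^-1]) ->
  forall t w H, St w H -> fail Q t H <= expR (pmin / 2 * (2 * w - t%:R)).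
Proof.
move=> pmin0 N0 St0 step; elim=> [|t IH] w H SwH.
  rewrite /= (@le_trans _ _ 1) ?lern1 ?leq_b1 // -expR0 ler_expR.
  by rewrite subr0 !mulr_ge0 ?invr_ge0 ?(ltW pmin0) ?(St0 _ _ SwH).
case: (step _ _ SwH) => [QH|[p [A [pminp pA HA]]]].
  exact: le_trans (fail_done _ QH) (expR_ge0 _).
have p0 : 0 < p by apply: lt_le_trans pminp.
set E := expR (pmin / 2 * (2 * w - t%:R)).
set x := expR (- (pmin / p)).
have E0 : 0 < E by apply: expR_gt0.
have y01 : 0 <= pmin / p <= 1.
  by rewrite divr_ge0 ?(ltW p0) ?(ltW pmin0) //= ler_pdivrMr // mul1r.
have x1 : x <= 1 - pmin / p / 2 by apply: expRN_le.
(* An offer in [A] multiplies the bound [E] by at most [x]; any other is ignored. As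
   [1 - x >= pmin / (2 * p)] and [A] has proportion at least [p], the mean is at most
   [E * (1 - pmin / 2)]. *)
apply: (@le_trans _ _ ((\sum_U (if U \in A then E * x else E)) / #|offer r n|%:R)).
  apply: fail_le_average => U; case: ifP => UA.
    have [a la [w' Sw' w'w]] := HA _ UA; exists a => //.
    apply: le_trans (IH _ _ Sw') _; rewrite /E /x -expRD ler_expR.
    rewrite -subr_ge0.
    have -> : pmin / 2 * (2 * w - t%:R) + - (pmin / p) - pmin / 2 * (2 * w' - t%:R)
      = pmin * (w - p^-1 - w') by field; lra.
    by rewrite mulr_ge0 ?(ltW pmin0) // subr_ge0.
  by exists None => //; apply: IH.
have -> : \sum_U (if U \in A then E * x else E)
    = E * (#|offer r n|%:R - (1 - x) * #|A|%:R).
  have -> : \sum_U (if U \in A then E * x else E)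
     = \sum_(U : offer r n) (E - (if U \in A then E * (1 - x) else 0)).
    by apply: eq_bigr => U _; case: ifP => _; ring.
  rewrite sumrB -big_mkcond /= !sumr_const.
  by rewrite -[E *+ _]mulr_natr -[_ *+ #|A|]mulr_natr; ring.
rewrite ler_pdivrMr ?ltr0n //.
apply: (@le_trans _ _ (E * (1 - pmin / 2) * #|offer r n|%:R)).
  rewrite -mulrA ler_wpM2l ?(ltW E0) //.
  have N1 : 0 < #|offer r n|%:R :> R by rewrite ltr0n.
  have : pmin / p / 2 * (p * #|offer r n|%:R) <= (1 - x) * #|A|%:R.
    apply: ler_pM => //; last by lra.
      by rewrite divr_ge0 //; case/andP: y01.
    by rewrite mulr_ge0 ?(ltW p0) ?(ltW N1).
  have -> : pmin / p / 2 * (p * #|offer r n|%:R) = pmin / 2 * #|offer r n|%:R.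
    by field; lra.
  lra.
rewrite ler_wpM2r ?ler0n //.
have -> : pmin / 2 * (2 * w - t.+1%:R)
    = pmin / 2 * (2 * w - t%:R) + - (pmin / 2) by rewrite -natr1; ring.
rewrite expRD ler_wpM2l ?(ltW E0) //.
by have := expR_ge1Dx (- (pmin / 2)); lra.
Qed.

End Bounds.

(** * Offers that meet two disjoint sets *)

Lemma card_offer r n : #|offer r n| = 'C(n, r).
Proof. by rewrite card_sig -[in RHS](card_ord n) -card_draws cardsE. Qed.

Definition offer_of r n (W : {set 'I_n}) (hW : #|W| == r) : offer r n :=
  exist (fun A : {set 'I_n} => #|A| == r) W hW.

Definition crossing n (P F : {set 'I_n}) : {set offer 2 n} :=
  [set U | [exists y in P, exists z in F, val U == [set y; z]]].

Lemma crossingP n (P F : {set 'I_n}) (U : offer 2 n) : U \in crossing P F ->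
  exists y z, [/\ y \in P, z \in F & val U = [set y; z]].
Proof.
by rewrite inE => /exists_inP[y yP] /exists_inP[z zF /eqP]; exists y, z.
Qed.

Lemma set2_disjoint_inj (T : finType) (P F : {set T}) y z y' z' : [disjoint P & F] ->
  y \in P -> z \in F -> y' \in P -> z' \in F -> [set y; z] = [set y'; z'] ->
  y = y' /\ z = z'.
Proof.
move=> dPF yP zF yP' zF' e.
have Pneq u v : u \in P -> v \in F -> u != v.
  by move=> uP vF; apply/eqP => uv; move: (disjointFr dPF uP); rewrite uv vF.
have : y \in [set y'; z'] by rewrite -e !inE eqxx.
have : z \in [set y'; z'] by rewrite -e !inE eqxx orbT.
rewrite !inE (negPf (Pneq _ _ yP zF')) orbF.
by rewrite eq_sym (negPf (Pneq _ _ yP' zF)) /= => /eqP-> /eqP->.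
Qed.

(** Disjointness lets an unordered offer determine its ordered pair in the product of [P] and
    [F]. *)
Lemma card_crossing n (P F : {set 'I_n}) : [disjoint P & F] ->
  (#|P| * #|F| <= #|crossing P F|)%N.
Proof.
move=> dPF; rewrite -cardsX -(card_imset _ val_inj).
rewrite -(card_in_imset (f := fun p => [set p.1; p.2])); last first.
  move=> [y z] [y' z']; rewrite !inE /= => /andP[yP zF] /andP[yP' zF'].
  by case/(set2_disjoint_inj dPF yP zF yP' zF') => -> ->.
apply: subset_leq_card; apply/fintype.subsetP => W /imsetP[[y z]].
rewrite !inE /= => /andP[yP zF] ->.
have W2 : #|[set y; z]| == 2.
  by rewrite cards2 (_ : y != z) //; apply/eqP => yz; move: (disjointFr dPF yP); rewrite yz zF.
apply/imsetP; exists (offer_of W2) => //.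
by rewrite inE; apply/exists_inP; exists y => //; apply/exists_inP; exists z.
Qed.

(** * One random vertex against two *)

Section OneOffer.
Variables (R : realType) (s n : nat).
Hypotheses (s2 : (2 <= s)%N) (n2 : (2 <= n)%N).
Notation graph := {set {set 'I_n}}.

(* The player with one random vertex chooses the second one as well as possible,
   hence at least as well as at random. *)
Definition split_reply (u : 'I_n) (W : {set 'I_n}) (a : reply n) : reply n :=
  omap (fun A => A :|: (W :\ u)) a.

Lemma split_replyE H (u : 'I_n) (U : offer 1 n) (W : offer 2 n) a :
  val U = [set u] -> u \in val W ->
  add_round H (U, split_reply u (val W) a) = add_round H (W, a).
Proof.
rewrite /add_round; case: a => [A|] //= -> uW; congr (_ |: _).
by rewrite setUCA setUC setD1K // finset.setUC.
Qed.

Lemma split_reply_legal (u : 'I_n) (U : offer 1 n) (W : offer 2 n) a :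
  val U = [set u] -> u \in val W ->
  legal_reply s W a -> legal_reply s U (split_reply u (val W) a).
Proof.
case: a => [A|] //= -> uW /andP[/eqP cA dA].
have uA : u \notin A by apply: contraL dA => uA; apply/pred0Pn; exists u; rewrite /= uA.
rewrite disjoint_sym disjoints1 in_setU in_setD1 eqxx /= orbF uA /= andbT.
rewrite cardsU cA [_ :&: _](_ : _ = set0) ?cards0.
  have c2 : #|sval W| = 2 := eqP (valP W).
  have := cardsD1 u (sval W); rewrite uW c2 add1n => -[<-]; lia.
by apply/eqP; rewrite setI_eq0 (disjointWr _ dA) // subD1set.
Qed.

(** A uniform vertex followed by a uniform pair through it is a uniform pair. Given [u], the pair
    [W1] through [u] with the least [phi] is no worse than the average over all such pairs, and the
    reply to [W1] is copied with the other vertex of [W1] added. *)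
Lemma fail_one_offer (Q : graph -> Prop) t H : @fail R 1 s n Q t H <= @fail R 2 s n Q t H.
Proof.
elim: t H => [|t IH] H //.
pose phi W := fail R 2 s Q t (add_round H (W, best R s Q t H (W : offer 2 n))).
have phi0 W : 0 <= phi W by apply: fail_ge0.
pose g (U : offer 1 n) := (\sum_(W : offer 2 n | val U \subset val W) phi W) / (n - 1)%:R.
have n1 : 0 < (n - 1)%:R :> R by rewrite ltr0n subn_gt0.
apply: (@le_trans _ _ ((\sum_U g U) / #|offer 1 n|%:R)).
  apply: fail_le_average => U.
  have /cards1P[u Uu] := valP U.
  pose uW := [pred W : offer 2 n | val U \subset val W].
  have cW : (n - 1 <= #|uW|)%N.
    have := @card_crossing n [set u] [set~ u].
    rewrite cards1 mul1n cardsC1 card_ord subn1 => /(_ _)/leq_trans; apply.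
      by rewrite disjoints1 !inE eqxx.
    apply: subset_leq_card; apply/fintype.subsetP => W /crossingP[y [z [/set1P -> _ eW]]].
    by rewrite inE Uu eW sub1set !inE eqxx.
  have [W0 W0u] : exists W0, W0 \in uW by apply/card_gt0P; apply: leq_trans cW; lia.
  pose W1 := [arg min_(W < W0 | uW W) phi W]%O.
  have [W1u W1min] : uW W1 /\ forall W, uW W -> phi W1 <= phi W.
    by rewrite /W1; case: arg_minP => // W ? ?; split.
  have uW1 : u \in val W1 by move: W1u; rewrite inE Uu sub1set.
  exists (split_reply u (val W1) (best R s Q t H W1)).
    by apply: split_reply_legal => //; apply: best_legal.
  rewrite split_replyE //; apply: le_trans (IH _) _.
  rewrite /g ler_pdivlMr // (@le_trans _ _ (phi W1 * #|uW|%:R)) //.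
    by rewrite ler_wpM2l ?ler_nat // phi0.
  rewrite mulr_natr -sumr_const; apply: ler_sum => W; exact: W1min.
have -> : @fail R 2 s n Q t.+1 H = (\sum_W phi W) / #|offer 2 n|%:R by [].
rewrite -mulr_suml (exchange_big_dep predT) //=.
(* Each pair is counted once for each of its two vertices, and [2 / (n * (n - 1))] is the inverse of
   the number of pairs. *)
have -> : \sum_(W : offer 2 n) \sum_(U : offer 1 n | val U \subset val W) phi W
          = 2 * \sum_W phi W.
  rewrite mulr_sumr; apply: eq_bigr => W _; rewrite sumr_const mulr_natl.
  congr (_ *+ _); have c2 : #|sval W| = 2 := eqP (valP W).
  apply: etrans c2.
  rewrite -(card_imset _ (@set1_inj 'I_n)) -(card_imset _ val_inj).
  apply: eq_card => A; apply/imsetP/imsetP.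
    case=> U; rewrite unfold_in /= => UW ->; have /cards1P[u Uu] := valP U.
    by exists u => //; rewrite -sub1set -Uu.
  case=> u uW ->.
  have c1 : #|[set u]| == 1 by rewrite cards1.
  by exists (offer_of c1) => //; rewrite unfold_in /= sub1set.
rewrite !card_offer bin1 bin2.
have -> : (n * n.-1)./2%:R = n%:R * (n - 1)%:R / 2 :> R.
  have := bin2_sum n; have := odd_double_half (n * n.-1); rewrite oddM.
  have -> : odd n && odd n.-1 = false by case: (n) n2 => // k _; rewrite /= andNb.
  rewrite add0n -mul2n => e _.
  by rewrite subn1 -natrM -[in RHS]e natrM mulrAC divff ?mul1r // pnatr_eq0.
have n0 : 0 < n%:R :> R by rewrite ltr0n; lia.
rewrite le_eqVlt; apply/orP; left; apply/eqP.
by field; rewrite ?gt_eqF.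
Qed.
End OneOffer.

(** * Matchings in mixing bipartite graphs *)

Section Marriage.
Variables (T : finType) (e : rel T).
Implicit Types (S D Y : {set T}).

Definition neighbours Y S := [set x in Y | [exists j in S, e j x]].

Lemma neighboursP Y S x :
  reflect (x \in Y /\ exists2 j, j \in S & e j x) (x \in neighbours Y S).
Proof.
rewrite inE; apply: (iffP andP) => [[xY /exists_inP[j]]|[xY [j jS ejx]]].
  by split=> //; exists j.
by split=> //; apply/exists_inP; exists j.
Qed.

Lemma sub_neighbours Y S : neighbours Y S \subset Y.
Proof. by apply/fintype.subsetP => x /neighboursP[]. Qed.

(** Hall's theorem, by induction on [#|D|]: either a nonempty proper subset is tight and splits the
    problem, or none is tight and any edge may be chosen first. *)
Lemma marriage D Y :
  (forall S, S \subset D -> (#|S| <= #|neighbours Y S|)%N) ->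
  exists f : T -> T, {in D &, injective f} /\
    forall j, j \in D -> f j \in Y /\ e j (f j).
Proof.
have [k] := ubnP #|D|; elim: k D Y => // k IH D Y Dk hall.
have [->|[j0 j0D]] := set_0Vmem D.
  by exists id; split=> [x y|j]; rewrite inE.
have [/existsP[S /and4P[SD S0 SnD /eqP cS]]|tight] :=
  boolP [exists S : {set T}, [&& S \subset D, S != finset.set0, S != D
                               & #|neighbours Y S| == #|S|]].
  have SltD : (#|S| < #|D|)%N by apply: proper_card; rewrite properEneq SnD.
  have S_gt0 : (0 < #|S|)%N by rewrite finset.card_gt0.
  have cDS : (#|D| = #|S| + #|D :\: S|)%N by rewrite -(cardsID S) (finset.setIidPr SD).
  have [||f [finj fY]] := IH S Y; first by lia.
    by move=> S' S'S; apply: hall; apply: fintype.subset_trans SD.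
  have [||g [ginj gY]] := IH (D :\: S) (Y :\: neighbours Y S); first by lia.
    move=> S' S'DS; have dS : [disjoint S & S'].
      rewrite disjoint_sym; apply: disjointWl S'DS _.
      by rewrite -setI_eq0 finset.setIC finset.setIDA finset.setDIl finset.setDv finset.set0I.
    have := hall (S :|: S'); rewrite finset.subUset SD /=.
    rewrite (fintype.subset_trans S'DS) ?finset.subsetDl // => /(_ isT).
    rewrite cardsU (eqP (_ : S :&: S' == finset.set0)) ?setI_eq0 // cards0 subn0.
    (* Hall's condition for [S'] outside the neighbours of the tight set [S] is the condition for
       [S :|: S'] with [#|S|] subtracted on both sides. *)
    move=> le; have : (#|neighbours Y (S :|: S')| <= #|neighbours Y S|
                    + #|neighbours (Y :\: neighbours Y S) S'|)%N; last by lia.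
    apply: leq_trans (leq_card_setU _ _).
    apply: subset_leq_card; apply/fintype.subsetP => x /neighboursP[xY [j jSS ejx]].
    case: (boolP (x \in neighbours Y S)) => [xN|xN]; first by rewrite finset.in_setU xN.
    case/finset.setUP: jSS => [jS|jS'].
    - by case/neighboursP: xN; split=> //; exists j.
    - rewrite finset.in_setU (negPf xN) /=; apply/neighboursP; split; last by exists j.
      by rewrite finset.in_setD xN.
  exists (fun j => if j \in S then f j else g j); split=> [i j iD jD|j jD]; last first.
    case: ifP => jS; first exact: fY.
    by have [|/finset.setDP[]] := gY j; rewrite // finset.in_setD jS.
  have fg i' j' : i' \in S -> j' \in D :\: S -> f i' <> g j'.
    move=> iS jDS fgE; have [/finset.setDP[_ /negP nb] _] := gY _ jDS; apply: nb.
    by rewrite -fgE; apply/neighboursP; have [? ?] := fY _ iS; split=> //; exists i'.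
  have iDS i' : i' \in D -> i' \in S = false -> i' \in D :\: S by rewrite finset.in_setD => -> ->.
  case: ifP => iS; case: ifP => jS.
  - exact: finj.
  - by move/(fg _ _ iS (iDS _ jD jS)).
  - by move/esym/(fg _ _ jS (iDS _ iD iS)).
  - by apply: ginj; apply: iDS.
have strict S : S \subset D -> S != finset.set0 -> S != D -> (#|S| < #|neighbours Y S|)%N.
  move=> SD S0 SnD; rewrite ltn_neqAle hall // andbT eq_sym; move: tight.
  by rewrite negb_exists => /forallP/(_ S); rewrite SD S0 SnD.
have : (0 < #|neighbours Y [set j0]|)%N.
  by apply: leq_trans (hall [set j0] _); rewrite ?cards1 ?sub1set.
case/card_gt0P => x0 /neighboursP[x0Y [j /finset.set1P -> ej0]].
have [||f [finj fY]] := IH (D :\ j0) (Y :\ x0).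
- by have := cardsD1 j0 D; rewrite j0D; lia.
- move=> S SD; have [->|S0] := eqVneq S finset.set0; first by rewrite cards0.
  have SD' : S \subset D by apply: fintype.subset_trans SD (subD1set _ _).
  have SnD : S != D.
    by apply: contraTneq SD => ->; apply/fintype.subsetPn; exists j0 => //; rewrite !inE eqxx.
  have le := strict S SD' S0 SnD.
  (* Deleting [x0] costs at most one neighbour, which the strict inequality pays for. *)
  have : (#|neighbours Y S| <= (#|neighbours (Y :\ x0) S|).+1)%N; last by lia.
  apply: leq_trans (_ : #|x0 |: neighbours (Y :\ x0) S| <= _)%N; last first.
    by rewrite cardsU1 -add1n leq_add2r leq_b1.
  apply: subset_leq_card; apply/fintype.subsetP => x /neighboursP[xY xS].
  rewrite in_setU1; have [//|/= xx0] := eqVneq x x0.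
  by apply/neighboursP; split=> //; rewrite !inE xx0.
have fD i : i \in D -> i != j0 -> f i \in Y :\ x0 /\ e i (f i) by move=> iD ij; apply: fY;
  rewrite !inE ij.
exists (fun j => if j == j0 then x0 else f j); split=> [i1 i2 iD jD|i iD]; last first.
  by case: eqVneq => [->//|ij]; have [/setD1P[]] := fD _ iD ij.
case: eqVneq => [->|ij]; case: eqVneq => [->|jj] //.
- by have [/setD1P[/eqP ne _] _] := fD _ jD jj; move/esym.
- by have [/setD1P[/eqP ne _] _] := fD _ iD ij.
- by apply: finj; rewrite !inE ?ij ?jj.
Qed.

End Marriage.

(** * A robust Hall condition from mixing *)

Section Expansion.
Variable T : finType.
Implicit Types (e : rel T) (I X Y A B U D S : {set T}) (a : nat).

Definition mixing e a I X := forall S Y, S \subset I -> Y \subset X ->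
  (a <= #|S|)%N -> (a <= #|Y|)%N -> exists j x, [/\ j \in S, x \in Y & e j x].

Definition transpose e : rel T := fun x j => e j x.

(** The strict inequality is a surplus of one; it pays for the one vertex that the matching may
    leave out. *)
Definition expanding e a I Y := forall U, U \subset I -> U != finset.set0 ->
  (#|U| <= a)%N -> (#|U| < #|neighbours e Y U|)%N.

Lemma mixing_transpose e a I X : mixing e a I X -> mixing (transpose e) a X I.
Proof.
by move=> mix Y S YX SI aY aS; have [j [x [jS xY ejx]]] := mix S Y SI YX aS aY; exists x, j.
Qed.

Lemma mixing_uncovered e a I X S Y : mixing e a I X -> S \subset I -> Y \subset X ->
  (0 < a)%N -> (a <= #|S|)%N -> (#|Y :\: neighbours e Y S| < a)%N.
Proof.
move=> mix SI YX a0 aS; rewrite ltnNge; apply/negP => aY.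
have [|j [x [jS /finset.setDP[xY /negP nx] ejx]]] := mix _ _ SI _ aS aY.
  exact: fintype.subset_trans (finset.subsetDl _ _) YX.
by apply: nx; apply/neighboursP; split=> //; exists j.
Qed.

(** Fewer than [a] vertices of [Y] are missed, so more than [2 * a] are met. No non-expanding set
    can therefore have size between [a] and [2 * a]. *)
Lemma mixing_neighbours e a I X S Y : mixing e a I X -> S \subset I -> Y \subset X ->
  (0 < a)%N -> (a <= #|S|)%N -> (#|S| <= 2 * a)%N -> (3 * a <= #|Y|)%N ->
  (#|S| < #|neighbours e Y S|)%N.
Proof.
move=> mix SI YX a0 aS S2a Y3a; have := mixing_uncovered mix SI YX a0 aS.
by have := cardsDS (sub_neighbours e Y S); lia.
Qed.

Lemma neighboursS e Y Y' S : Y \subset Y' -> neighbours e Y S \subset neighbours e Y' S.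
Proof.
move/fintype.subsetP => YY'; apply/fintype.subsetP => x /neighboursP[/YY' xY xS].
exact/neighboursP.
Qed.

Lemma card_neighboursU e Y S S' :
  (#|neighbours e Y (S :|: S')| <= #|neighbours e Y S| + #|neighbours e Y S'|)%N.
Proof.
apply: leq_trans (leq_card_setU _ _).
apply: subset_leq_card; apply/fintype.subsetP => x /neighboursP[xY [j jS ejx]].
by apply/finset.setUP; case/finset.setUP: jS => jS; [left|right]; apply/neighboursP; split=>
  //; exists j.
Qed.

Lemma cardsU_disjoint A B : [disjoint A & B] -> #|A :|: B| = (#|A| + #|B|)%N.
Proof. by rewrite -setI_eq0 cardsU => /eqP->; rewrite cards0 subn0. Qed.

Lemma card_setU_disjoint A U I : U \subset I :\: A -> #|A :|: U| = (#|A| + #|U|)%N.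
Proof. by rewrite finset.subsetD disjoint_sym => /andP[_ /cardsU_disjoint]. Qed.

(* A largest pair of small sets that fails to expand is removed: any further
   small non-expanding set could be added to it. *)
Lemma mixing_expanding e a I X (XA : {set T}) : mixing e a I X -> XA \subset X -> (0 < a)%N ->
  (4 * a <= #|I|)%N -> (4 * a <= #|XA|)%N ->
  exists A B, [/\ A \subset I, B \subset X, (#|A| <= a)%N & (#|B| <= a)%N] /\
    expanding e a (I :\: A) (XA :\: B) /\ expanding (transpose e) a (X :\: B) (I :\: A).
Proof.
move=> mix XAX a0 I4a XA4a.
pose P (p : {set T} * {set T}) := [&& p.1 \subset I, p.2 \subset X,
  (#|p.1| <= a)%N, (#|p.2| <= a)%N,
  (#|neighbours e (XA :\: p.2) p.1| <= #|p.1|)%N &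
  (#|neighbours (transpose e) (I :\: p.1) p.2| <= #|p.2|)%N].
have nb0 (e1 : rel T) Y : neighbours e1 Y finset.set0 = finset.set0.
  by apply/setP => x; rewrite !inE; apply/negbTE; rewrite negb_and; apply/orP; right;
     apply/exists_inP => -[j]; rewrite inE.
have P0 : P (finset.set0, finset.set0) by rewrite /P /= !finset.sub0set !nb0 cards0.
case: (@arg_maxnP _ (finset.set0, finset.set0) P (fun p => #|p.1| + #|p.2|)%N P0).
case=> A B /and5P[/= AI BX Aa Ba /andP[nA nB]] maxAB; exists A, B; split=> //.
have cXA : (3 * a <= #|XA :\: B|)%N.
  by have := subset_leq_card (finset.subsetIr XA B); rewrite cardsD; lia.
have cI : (3 * a <= #|I :\: A|)%N by rewrite cardsDS //; lia.
split=> U UIA U0 Ua; rewrite ltnNge; apply/negP => nU.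
- have cAU := card_setU_disjoint UIA.
  have U_gt0 : (0 < #|U|)%N by rewrite finset.card_gt0.
  have AUI : A :|: U \subset I.
    by rewrite finset.subUset AI (fintype.subset_trans UIA) // finset.subsetDl.
  have nAU : (#|neighbours e (XA :\: B) (A :|: U)| <= #|A :|: U|)%N.
    by rewrite cAU; apply: leq_trans (card_neighboursU _ _ _ _) _; lia.
  (* A union of size at most [a] contradicts maximality; a larger one has size between [a] and
     [2 * a], where mixing forces expansion. *)
  have [AUa|aAU] := leqP #|A :|: U| a.
    have : P (A :|: U, B).
      rewrite /P /= AUI BX AUa Ba nAU /=; apply: leq_trans nB; apply: subset_leq_card.
      by apply: neighboursS; apply: finset.setDS; apply: finset.subsetUl.
    by move/maxAB; rewrite /= cAU; lia.
  have := mixing_neighbours mix AUI (fintype.subset_trans (finset.subsetDl _ B) XAX) a0 (ltnW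
    aAU).
  by rewrite cAU in nAU *; lia.
- have cBU := card_setU_disjoint UIA.
  have U_gt0 : (0 < #|U|)%N by rewrite finset.card_gt0.
  have BUX : B :|: U \subset X.
    by rewrite finset.subUset BX (fintype.subset_trans UIA) // finset.subsetDl.
  have nBU : (#|neighbours (transpose e) (I :\: A) (B :|: U)| <= #|B :|: U|)%N.
    by rewrite cBU; apply: leq_trans (card_neighboursU _ _ _ _) _; lia.
  have [BUa|aBU] := leqP #|B :|: U| a.
    have : P (A, B :|: U).
      rewrite /P /= AI BUX Aa BUa nBU andbT /=; apply: leq_trans nA; apply: subset_leq_card.
      by apply: neighboursS; apply: finset.setDS; apply: finset.subsetUl.
    by move/maxAB; rewrite /= cBU; lia.
  have := mixing_neighbours (mixing_transpose mix) BUX (finset.subsetDl I A) a0 (ltnW aBU).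
  by rewrite cBU in nBU *; lia.
Qed.

(** Here [Y] may be any set between [XA1] and [X1], since the available vertices are known only at
    the end. Sets [S] of size at most [a] expand into [XA1]; a larger [S] misses a set [V] of fewer
    than [a] vertices of [Y], and [V] expands back into [I1 :\: S]. *)
Lemma expanding_matching e a I X (I1 XA1 X1 : {set T}) D Y :
  mixing e a I X -> (0 < a)%N -> I1 \subset I -> X1 \subset X ->
  expanding e a I1 XA1 -> expanding (transpose e) a X1 I1 ->
  D \subset I1 -> (#|I1| <= #|D|.+1)%N -> XA1 \subset Y -> Y \subset X1 ->
  (#|D| <= #|Y|)%N ->
  exists f : T -> T, {in D &, injective f} /\
    forall j, j \in D -> f j \in Y /\ e j (f j).
Proof.
move=> mix a0 I1I X1X expI expX DI cD XAY YX cDY; apply: marriage => S SD.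
have SI1 : S \subset I1 by apply: fintype.subset_trans DI.
have [->|S0] := eqVneq S finset.set0; first by rewrite cards0.
have [Sa|/ltnW aS] := leqP #|S| a.
  apply: leq_trans (subset_leq_card (neighboursS _ _ XAY)); apply: ltnW; exact: expI.
have YX' : Y \subset X by apply: fintype.subset_trans X1X.
set V := Y :\: neighbours e Y S.
have cV : (#|V| < a)%N by apply: mixing_uncovered mix _ _ _ _ => //; apply:
  fintype.subset_trans I1I.
have cY := cardsDS (sub_neighbours e Y S).
have cS := subset_leq_card SD.
have [V0|V0] := eqVneq V finset.set0.
  by move: cY; rewrite -/V V0 cards0; clear -cDY cS; lia.
have VX1 : V \subset X1 by apply: fintype.subset_trans (finset.subsetDl _ _) _.
have := expX V VX1 V0 (ltnW cV).
have : (#|neighbours (transpose e) I1 V| <= #|I1 :\: S|)%N.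
  apply: subset_leq_card; apply/fintype.subsetP => j /neighboursP[jI [x xV ejx]].
  rewrite finset.in_setD jI andbT; apply: contraL xV => jS.
  rewrite finset.in_setD negb_and negbK; have [xY|nxY] := boolP (x \in Y); last by rewrite orbT.
  by rewrite orbF; apply/neighboursP; split=> //; exists j.
have nY := subset_leq_card (sub_neighbours e Y S).
have cSI := subset_leq_card SI1.
rewrite (cardsDS SI1); rewrite -/V in cY; clear -cY cS cD cDY nY cSI; lia.
Qed.

End Expansion.

(** * Loose cycles from cyclic chains of triples *)

Lemma card_interval n lo hi : (hi <= n)%N ->
  #|[set v : 'I_n | (lo <= v < hi)%N]| = (hi - lo)%N.
Proof.
move=> hn; have lt (k : 'I_(hi - lo)) : (lo + k < n)%N by have := ltn_ord k; lia.
pose g k := Ordinal (lt k).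
have ginj : injective g by move=> k k' /(congr1 val) /= /addnI; apply: val_inj.
rewrite -[RHS]card_ord -cardsT -(card_imset _ ginj); apply: eq_card => v.
rewrite inE; apply/andP/imsetP => [[v1 v2]|[k _ ->]]; last first.
  by rewrite /= leq_addr; have := ltn_ord k; lia.
have kb : (v - lo < hi - lo)%N by lia.
by exists (Ordinal kb) => //; apply: val_inj => /=; lia.
Qed.

Section LooseCycle.
Variables (s n : nat).
Hypotheses (s3 : (3 <= s)%N) (sn : (s - 1 %| n)%N).
Notation graph := {set {set 'I_n}}.
Notation m := (n %/ (s - 1))%N.

Lemma n_split : n = (2 * m + m * (s - 3))%N.
Proof.
rewrite -[LHS](divnK sn) mulnC; set k := (n %/ _)%N.
have {1}-> : (s - 1 = 2 + (s - 3))%N by lia.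
by rewrite mulnDl [in RHS](mulnC k).
Qed.

Lemma core_le_n : (2 * m <= n)%N.
Proof. by rewrite [leqRHS]n_split leq_addr. Qed.

(* The vertices below [2 * m] are those of the 3-uniform problem; the remaining
   ones form [m] blocks of [s - 3] vertices, one for each label [l], and the block
   [pad l] completes a triple to an edge. *)
Definition core : {set 'I_n} := [set v : 'I_n | (v < 2 * m)%N].

Definition pad (l : nat) : {set 'I_n} :=
  [set v : 'I_n | (2 * m + l * (s - 3) <= v < 2 * m + l.+1 * (s - 3))%N].

Lemma pad_bound l k : (l < m)%N -> (k < s - 3)%N -> (2 * m + l * (s - 3) + k < n)%N.
Proof.
move=> lm ks; rewrite [X in (_ < X)%N]n_split.
have : (l.+1 * (s - 3) <= m * (s - 3))%N by rewrite leq_mul2r lm orbT.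
rewrite mulSn; lia.
Qed.

Lemma card_pad l : (l < m)%N -> #|pad l| = (s - 3)%N.
Proof.
move=> lm; rewrite card_interval; first by rewrite mulSn; lia.
by rewrite [leqRHS]n_split leq_add2l leq_mul2r lm orbT.
Qed.

Lemma core_pad v l : v \in core -> v \notin pad l.
Proof.
rewrite !inE => v1; rewrite negb_and -!ltnNge; apply/orP; left.
by apply: leq_trans v1 (leq_addr _ _).
Qed.

Definition edge (l : nat) (x y z : 'I_n) : {set 'I_n} := [set x; y; z] :|: pad l.

Lemma edge_rev l x y z : edge l x y z = edge l z y x.
Proof. by apply/setP => v; rewrite !inE; do 2 case: (v == _) => //; case: (v == _). Qed.

Lemma reply_edge (U : offer 2 n) l x y z : (l < m)%N ->
  x \in core -> y \in core -> z \in core -> z != x -> z != y -> val U = [set x; y] ->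
  exists2 a, legal_reply s U a & forall H, add_round H (U, a) = edge l x y z |: H.
Proof.
move=> lm xc yc zc zx zy eU; exists (Some (z |: pad l)); last first.
  by move=> H; rewrite /add_round /= /edge [X in X |: _](_ : _ = [set x; y; z] :|: pad l) //
    -finset.setUA -[sval U]/(val U) eU.
rewrite /legal_reply cardsU1 core_pad //= card_pad //; apply/andP; split; first by apply/eqP; lia.
rewrite -[sval U]/(val U) eU disjoint_sym disjoints_subset; apply/fintype.subsetP => v.
move=> /finset.set2P vxy; rewrite finset.in_setC; apply/negP => /finset.setU1P[vz|].
  by case: vxy => vE; move: zx zy; rewrite -vz vE eqxx.
by apply/negP/core_pad; case: vxy => ->.
Qed.

(** * From a cyclic list of entries (hub, label, middle) to a loose Hamilton cycle *)

Section Assembly.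
Variables (n0 : (0 < n)%N) (H : graph) (L : seq ('I_n * nat * 'I_n)).
Let c0 : 'I_n := Ordinal n0.
Let e0 := (c0, 0%N, c0).
Hypotheses (sizeL : size L = m)
  (cycL : cycle (fun u v => edge u.1.2 u.1.1 u.2 v.1.1 \in H) L)
  (uniqL : uniq ([seq u.1.1 | u <- L] ++ [seq u.2 | u <- L]))
  (coreL : {subset [seq u.1.1 | u <- L] ++ [seq u.2 | u <- L] <= core})
  (uniq_labels : uniq [seq u.1.2 | u <- L])
  (labelsL : all (fun u => u.1.2 < m)%N L).

Let hub q : 'I_n := (nth e0 L q).1.1.
Let label q : nat := (nth e0 L q).1.2.
Let mid q : 'I_n := (nth e0 L q).2.

(** The vertex at position [q * (s - 1) + k] of the cyclic ordering, for [k < s - 1]: hub, middle,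
    then padding. The last vertex of edge [q] is the hub of the next edge. *)
Let W q k : 'I_n :=
  if k == 0%N then hub q else if k == 1%N then mid q
  else insubd c0 (2 * m + label q * (s - 3) + (k - 2))%N.

Let label_lt q : (q < m)%N -> (label q < m)%N.
Proof. by move=> qm; apply: (all_nthP e0 labelsL); rewrite sizeL. Qed.

Let hubE q : (q < m)%N -> hub q = nth c0 [seq u.1.1 | u <- L] q.
Proof. by move=> qm; rewrite (nth_map e0) // sizeL. Qed.

Let midE q : (q < m)%N -> mid q = nth c0 [seq u.2 | u <- L] q.
Proof. by move=> qm; rewrite (nth_map e0) // sizeL. Qed.

Let hub_core q : (q < m)%N -> hub q \in core.
Proof. by move=> qm; apply: coreL; rewrite mem_cat hubE // mem_nth // size_map sizeL. Qed.

Let mid_core q : (q < m)%N -> mid q \in core.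
Proof. by move=> qm; apply: coreL; rewrite mem_cat orbC midE // mem_nth // size_map sizeL. Qed.

Let W_pad q k : (q < m)%N -> (2 <= k < s - 1)%N ->
  val (W q k) = (2 * m + label q * (s - 3) + (k - 2))%N.
Proof.
move=> qm /andP[k2 ks]; rewrite /W; case: eqP; first lia; case: eqP; first lia.
move=> _ _; rewrite val_insubd pad_bound //; [exact: label_lt | lia].
Qed.

Let W_core q k : (q < m)%N -> (k < 2)%N -> W q k \in core.
Proof. by move=> qm; case: k => [|[|]] // _; [apply: hub_core | apply: mid_core]. Qed.

Let W_notcore q k : (q < m)%N -> (2 <= k < s - 1)%N -> W q k \notin core.
Proof. by move=> qm ks; rewrite inE W_pad // -leqNgt -addnA leq_addr. Qed.

Let hub_inj q q' : (q < m)%N -> (q' < m)%N -> hub q = hub q' -> q = q'.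
Proof.
move=> qm qm'; rewrite !hubE // => /eqP; rewrite nth_uniq ?size_map ?sizeL // => [/eqP//|].
by move: uniqL; rewrite cat_uniq => /and3P[].
Qed.

Let mid_inj q q' : (q < m)%N -> (q' < m)%N -> mid q = mid q' -> q = q'.
Proof.
move=> qm qm'; rewrite !midE // => /eqP; rewrite nth_uniq ?size_map ?sizeL // => [/eqP//|].
by move: uniqL; rewrite cat_uniq => /and3P[].
Qed.

Let label_inj q q' : (q < m)%N -> (q' < m)%N -> label q = label q' -> q = q'.
Proof.
move=> qm qm'; rewrite /label -!(nth_map e0 0%N (fun u => u.1.2)) ?sizeL // => /eqP.
by rewrite nth_uniq ?size_map ?sizeL // => /eqP.
Qed.

Let hub_mid q q' : (q < m)%N -> (q' < m)%N -> hub q <> mid q'.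
Proof.
move=> qm qm' e; move: uniqL; rewrite cat_uniq => /and3P[_ /hasPn/(_ (mid q'))] + _.
rewrite midE // mem_nth ?size_map ?sizeL // => /(_ isT) /negP; apply.
by rewrite -midE // -e hubE // mem_nth // size_map sizeL.
Qed.

Let W_inj q q' k k' : (q < m)%N -> (q' < m)%N -> (k < s - 1)%N -> (k' < s - 1)%N ->
  W q k = W q' k' -> q = q' /\ k = k'.
Proof.
move=> qm qm' ks ks' e.
have [k2|k2] := ltnP k 2; have [k2'|k2'] := ltnP k' 2.
- move: k k' k2 k2' e {ks ks'} => [|[|]] // [|[|]] // _ _; rewrite /W /= => e.
  + by rewrite (hub_inj qm qm' e).
  + by case: (hub_mid qm qm').
  + by case: (hub_mid qm' qm).
  + by rewrite (mid_inj qm qm' e).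
- by have := W_core qm k2; rewrite e (negPf (W_notcore _ _)) ?k2' ?ks'.
- by have := W_core qm' k2'; rewrite -e (negPf (W_notcore _ _)) ?k2 ?ks.
- have e' : (label q * (s - 3) + (k - 2) = label q' * (s - 3) + (k' - 2))%N.
    by have := congr1 val e; rewrite !W_pad ?k2 ?k2' //; lia.
  have kk : ((k - 2) %% (s - 3) = (k' - 2) %% (s - 3))%N.
    by rewrite -(modnMDl (label q)) e' modnMDl.
  rewrite !modn_small in kk; try lia.
  have kE : k = k' by lia.
  split=> //; apply: label_inj => //; move: e'; rewrite kE => /addIn/eqP.
  by rewrite eqn_pmul2r ?subn_gt0; [move/eqP | lia].
Qed.

Let s1 : (0 < s - 1)%N. Proof. by lia. Qed.

Let w (i : 'I_n) : 'I_n := W (i %/ (s - 1))%N (i %% (s - 1))%N.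

Let div_lt (i : 'I_n) : (i %/ (s - 1) < m)%N.
Proof. by rewrite ltn_divLR // divnK. Qed.

Let w_inj : injective w.
Proof.
move=> i i' /W_inj; rewrite !ltn_pmod // !div_lt => /(_ isT isT isT isT) [e1 e2].
by apply: val_inj; rewrite /= (divn_eq i (s - 1)) (divn_eq i' (s - 1)) e1 e2.
Qed.

Let w_at (i : 'I_n) q k : (k < s - 1)%N -> val i = (q * (s - 1) + k)%N -> w i = W q k.
Proof.
move=> ks ei; have -> : q = (i %/ (s - 1))%N by rewrite ei divnMDl // divn_small // addn0.
by have -> : k = (i %% (s - 1))%N by rewrite ei modnMDl modn_small.
Qed.

Let cycle_at q : (q < m)%N -> edge (label q) (hub q) (mid q) (hub (q.+1 %% m)%N) \in H.
Proof.
move=> qm; move: cycL sizeL; rewrite /label /hub /mid; case: (L) => [|u p] /=.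
  by move=> _ e; move: qm; rewrite -e.
move=> /(pathP e0)/(_ q); rewrite size_rcons => step sp.
have := step; rewrite sp qm => /(_ isT).
have [qp|qp] := ltnP q.+1 m.
  have qp' : (q < size p)%N by rewrite -ltnS sp.
  by rewrite modn_small //= nth_rcons qp' -[u :: rcons p u]/(rcons (u :: p) u) nth_rcons /=
    ltnS ltnW.
have qE : q = size p by lia.
have -> : q.+1 = m by lia.
by rewrite modnn /= nth_rcons qE ltnn eqxx -[u :: rcons p u]/(rcons (u :: p) u) nth_rcons /=
  ltnSn.
Qed.

Lemma loose_Hamilton_of_cycle : has_loose_Hamilton_cycle s H.
Proof.
apply/existsP; exists (perm w_inj); apply/forallP => i.
have im := ltn_ord i; have m0 : (0 < m)%N by apply: leq_ltn_trans im.
have im' : (i.+1 %% m < m)%N by rewrite ltn_pmod.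
rewrite (_ : loose_edge _ _ _ = edge (label i) (hub i) (mid i) (hub (i.+1 %% m)%N)); first
  exact: cycle_at.
have nm : n = (m * (s - 1))%N by rewrite divnK.
have pos_lt q k : (q < m)%N -> (k < s - 1)%N -> (q * (s - 1) + k < n)%N.
  move=> qm ks; rewrite [X in (_ < X)%N]nm.
  have : (q.+1 * (s - 1) <= m * (s - 1))%N by rewrite leq_mul2r qm orbT.
  by rewrite mulSn; lia.
(* The last vertex of edge [i] is the first one of the next edge; for the last edge this is position
   [0]. *)
have lastE : ((i * (s - 1) + (s - 1)) %% n = (i.+1 %% m) * (s - 1))%N.
  by rewrite addnC -mulSn [X in (_ %% X)%N]nm muln_modl.
apply/setP => z; apply/imsetP/idP.
  case=> j; rewrite inE => /existsP[k /eqP jk] ->; rewrite permE.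
  have [ks|ks] := ltnP k (s - 1).
    rewrite modn_small ?pos_lt // in jk; rewrite (w_at ks jk).
    have [k2|k2] := ltnP k 2; last first.
      rewrite !inE W_pad ?k2 //; apply/orP; right; rewrite mulSn; lia.
    by case: (nat_of_ord k) k2 => [|[|]] // _; rewrite /W /= !inE eqxx ?orbT.
  have kE : nat_of_ord k = (s - 1)%N by have := ltn_ord k; lia.
  rewrite kE lastE -[X in _ = X]addn0 in jk.
  by rewrite (w_at s1 jk) /W /= !inE eqxx ?orbT.
have wit q k (kk : 'I_s) : (q < m)%N -> (k < s - 1)%N -> ((i * (s - 1) + kk) %% n = q * (s -
  1) + k)%N ->
   exists2 j : 'I_n, j \in [set j : 'I_n | [exists k : 'I_s, j == ((i * (s - 1) + k) %% n)%N
     :> nat]]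
     & W q k = perm w_inj j.
  move=> qm ks e; exists (Ordinal (pos_lt _ _ qm ks)); last by rewrite permE (@w_at _ q k).
  by rewrite inE; apply/existsP; exists kk; rewrite e.
have wit1 k : (k < s - 1)%N -> exists2 j : 'I_n,
     j \in [set j : 'I_n | [exists k : 'I_s, j == ((i * (s - 1) + k) %% n)%N :> nat]]
     & W i k = perm w_inj j.
  move=> ks; have ks' : (k < s)%N by lia.
  by apply: (wit i k (Ordinal ks')) => //; rewrite modn_small ?pos_lt.
rewrite in_setU => /orP[|zp]; last first.
  have zP : z = W i (z - (2 * m + label i * (s - 3)) + 2)%N.
    move: zp; rewrite inE [(_.+1 * (s - 3))%N]mulSn => zp; apply: val_inj.
    by rewrite W_pad /=; lia.
  rewrite zP; apply: wit1; move: zp; rewrite inE [(_.+1 * (s - 3))%N]mulSn; lia.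
rewrite !inE -orbA => /or3P[] /eqP->.
- by apply: (wit1 0%N).
- by apply: (wit1 1%N); lia.
- have ls : (s - 1 < s)%N by lia.
  by apply: (wit (i.+1 %% m)%N 0%N (Ordinal ls)) => //=; rewrite lastE addn0.
Qed.

End Assembly.
End LooseCycle.

(** * The slot phase *)

Section Slots.
Variables (R : realType) (s n a : nat).
Hypotheses (s3 : (3 <= s)%N) (sn : (s - 1 %| n)%N).
Notation graph := {set {set 'I_n}}.
Notation m := (n %/ (s - 1))%N.
Implicit Types (H : graph).

(* The slot [j] is the pair of hubs [j, j.+1]; its edges carry the label [j]. *)
Definition slots : {set 'I_n} := [set v : 'I_n | (v < m - 4 * a)%N].
(** The range starts after [m - 4 * a], the hub that ends the last slot and is itself neither slot
    nor middle. *)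
Definition middles : {set 'I_n} := [set v : 'I_n | (m - 4 * a < v < 2 * m)%N].

Definition slot_edge H : rel 'I_n := fun j x => edge s j j x (ordS j) \in H.

Lemma disjoint_slots_middles : [disjoint slots & middles].
Proof.
by rewrite disjoints_subset; apply/fintype.subsetP => v; rewrite !inE; lia.
Qed.

Lemma ordS_slot (j : 'I_n) : j \in slots -> val (ordS j) = j.+1.
Proof.
rewrite inE => jm; rewrite /= modn_small //.
by move: jm (core_le_n s3 sn); set q := (n %/ _)%N; lia.
Qed.

(** The reply depends on the offer alone, so one reply function serves all pairs of sets in the
    union bound at once. *)
Lemma reply_slot (U : offer 2 n) : exists a, legal_reply s U a /\
  (forall H, H \subset add_round H (U, a)) /\
  forall j x, j \in slots -> x \in middles -> val U = [set j; x] ->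
  forall H, slot_edge (add_round H (U, a)) j x.
Proof.
have [/existsP[[j x] /= /and3P[jI xX /eqP eU]]|none] :=
  boolP [exists jx : 'I_n * 'I_n, [&& jx.1 \in slots, jx.2 \in middles & val U == [set jx.1;
    jx.2]]].
  have Sj := ordS_slot jI; move: (jI) (xX); rewrite !inE => jm xm.
  have [|||||||b lb addE] := @reply_edge s n s3 sn U j j x (ordS j); rewrite ?inE ?Sj //; try lia.
  - by apply/eqP => /(congr1 val); rewrite Sj /=; lia.
  - by apply/eqP => /(congr1 val); rewrite Sj /=; lia.
  exists b; split=> //; split=> [H|j' x' jI' xX']; first by rewrite addE finset.subsetUr.
  rewrite eU => /(set2_disjoint_inj disjoint_slots_middles jI xX jI' xX')[<- <-] H.
  by rewrite /slot_edge addE finset.setU11.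
exists None; split=> //; split=> [H|j x jI xX eU]; first by rewrite /add_round.
by case/negP: none; apply/existsP; exists (j, x); rewrite /= jI xX eU eqxx.
Qed.

(** Union bound: [Phi] counts the pairs of large sets without an edge, at most [4 ^ n] of them at
    the start. Each is hit by at least [a * a] offers, a proportion of at least [p]. *)
Lemma fail_mixing (p : R) t : 0 <= p <= 1 -> p * #|offer 2 n|%:R <= (a * a)%:R ->
  @fail R 2 s n (fun H => mixing (slot_edge H) a slots middles) t finset.set0
    <= (1 - p) ^+ t * 4 ^+ n.
Proof.
move=> /andP[p0 p1] pN.
pose big (p : {set 'I_n} * {set 'I_n}) :=
  [&& p.1 \subset slots, p.2 \subset middles, (a <= #|p.1|)%N & (a <= #|p.2|)%N].
pose hit H (p : {set 'I_n} * {set 'I_n}) := [exists j in p.1, exists x in p.2, slot_edge H j x].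
pose Phi H : R := \sum_(p | big p) (~~ hit H p)%:R.
have Phi0 H : 0 <= Phi H by apply: sumr_ge0 => q _; apply: ler0n.
apply: le_trans (_ : (1 - p) ^+ t * Phi finset.set0 <= _); last first.
  rewrite ler_wpM2l ?exprn_ge0 ?subr_ge0 //.
  apply: (@le_trans _ _ (\sum_(q : {set 'I_n} * {set 'I_n}) 1)).
    rewrite /Phi big_mkcond ler_sum // => q _; case: ifP => _; rewrite ?ler01 //.
    by rewrite lern1 leq_b1.
  rewrite sumr_const card_prod -cardsT -powersetT card_powerset cardsT card_ord.
  by rewrite -expnMn -[_ *+ _]/(_%:R) natrX.
apply: fail_contract => //; first by rewrite subr_ge0.
  move=> H nmix; have [q /andP[bq hq]] : exists q, big q && ~~ hit H q.
    apply: contrapT => /forallNP none; apply: nmix => S Y SI YX aS aY.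
    have /negP := none (S, Y); rewrite /big /hit /= SI YX aS aY negbK.
    by case/exists_inP => j jS /exists_inP[x xY ejx]; exists j, x.
  rewrite /Phi (bigD1 q) //= hq lerDl; apply: sumr_ge0 => q' _; exact: ler0n.
move=> H; have [rep repP] := choice reply_slot.
exists rep => [U|]; first by have [] := repP U.
rewrite exchange_big /= mulrAC mulr_sumr; apply: ler_sum => -[S Y] /and4P[/= SI YX aS aY].
have [hSY|nSY] := boolP (hit H (S, Y)).
  rewrite mulr0 big1 // => U _; suff -> : hit (add_round H (U, rep U)) (S, Y) by [].
  case/exists_inP: hSY => j jS /exists_inP[x xY ejx].
  apply/exists_inP; exists j => //; apply/exists_inP; exists x => //.
  by have [_ [/(_ H)/fintype.subsetP sub _]] := repP U; apply: sub.
rewrite mulr1.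
have dSY : [disjoint S & Y] by apply: disjointWl SI (disjointWr YX disjoint_slots_middles).
have cross : (a * a <= #|crossing S Y|)%N.
  by apply: leq_trans (card_crossing dSY); apply: leq_mul.
apply: (@le_trans _ _ (\sum_(U : offer 2 n) (U \notin crossing S Y)%:R)).
  apply: ler_sum => U _; rewrite ler_nat; case: (boolP (U \in _)) => [|_]; last by rewrite leq_b1.
  case/crossingP => j [x [jS xY eU]]; have [_ [_ hjx]] := repP U.
  suff -> : hit (add_round H (U, rep U)) (S, Y) by [].
  apply/exists_inP; exists j => //; apply/exists_inP; exists x => //; apply: hjx => //.
    exact: (fintype.subsetP SI).
  exact: (fintype.subsetP YX).
have -> : \sum_(U : offer 2 n) (U \notin crossing S Y)%:R = #|~: crossing S Y|%:R :> R.
  rewrite -sum1_card natr_sum [RHS]big_mkcond; apply: eq_bigr => U _ /=.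
  by rewrite finset.in_setC; case: (U \in crossing S Y).
have -> : #|~: crossing S Y|%:R = #|offer 2 n|%:R - #|crossing S Y|%:R :> R.
  by rewrite -(cardsC (crossing S Y)) natrD addrAC subrr add0r.
by rewrite mulrBl mul1r lerD2l lerN2 (le_trans pN) // ler_nat.
Qed.

End Slots.

(** * The linking phase *)

Lemma uniq_map_inj (T1 T2 : eqType) (f : T1 -> T2) (r : seq T1) :
  uniq [seq f i | i <- r] -> {in r &, injective f}.
Proof.
elim: r => [|u r IH] //= /andP[nu ur] x y; rewrite !inE.
move=> /orP[/eqP->|xr] /orP[/eqP->|yr] // e; last exact: IH.
  by case/negP: nu; rewrite e map_f.
by case/negP: nu; rewrite -e map_f.
Qed.

Lemma subset_of_card (T : finType) (A : {set T}) k : (k <= #|A|)%N ->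
  exists2 B : {set T}, B \subset A & #|B| = k.
Proof.
case/card_geqP => r [ur sr rA]; exists [set x in r].
  by apply/fintype.subsetP => x; rewrite inE; apply: rA.
by rewrite cardsE -sr; apply/card_uniqP.
Qed.

Lemma half_leq_sub k : (k./2 <= k - k./2)%N.
Proof. lia. Qed.

Lemma room_left f k g : (f + 3 * k.+1 <= g)%N -> (f + 3 * k <= g - 3)%N.
Proof. lia. Qed.

Section Linking.
Variables (R : realType) (s n : nat).
Hypotheses (s3 : (3 <= s)%N) (sn : (s - 1 %| n)%N).
Notation graph := {set {set 'I_n}}.
Notation m := (n %/ (s - 1))%N.
Implicit Types (H : graph) (us F : {set 'I_n}).

Variables (links reserve : {set 'I_n}) (next_hub : 'I_n -> 'I_n) (l1 l2 : 'I_n -> nat).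
Hypotheses (reserve_core : reserve \subset core s n)
  (links_core : forall v, v \in links -> v \in core s n /\ v \notin reserve)
  (next_core : forall v, v \in links -> next_hub v \in core s n /\ next_hub v \notin reserve)
  (l1_lt : forall v, v \in links -> (l1 v < m)%N)
  (l2_lt : forall v, v \in links -> (l2 v < m)%N).

Variables (Good : {set 'I_n} -> {set 'I_n} -> graph -> Prop) (Q : graph -> Prop).
Hypotheses (good_mono : forall us F H H', Good us F H -> H \subset H' -> Good us F H')
  (good_link : forall us F H v x y z, Good us F H -> us \subset links -> F \subset reserve ->
     v \in us -> x \in F -> y \in F -> z \in F -> uniq [:: x; y; z] ->
     edge s (l1 v) v x y \in H -> edge s (l2 v) y z (next_hub v) \in H ->
     Good (us :\ v) (F :\: [set x; y; z]) H)
  (good_done : forall F H, Good finset.set0 F H -> Q H).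

(* With [K] unlinked hubs, each of them is given [M K] marks: a mark [(v, x, y)]
   is an edge from [v] to [y] through [x], and an offer [{y, z}] turns it into
   a link. *)
Variables (K0 f0 f1 : nat) (M : nat -> nat) (b : nat -> R) (c pmin : R).
Hypotheses (c0 : 0 < c) (pmin0 : 0 < pmin) (pminc : pmin <= c)
  (M_mono : forall K, (0 < K)%N -> (M K.+1 <= M K)%N)
  (b0 : forall K, (0 < K)%N -> 0 < b K)
  (pminb : forall K, (0 < K <= K0)%N -> pmin <= c / b K)
  (room : forall K, (0 < K <= K0)%N -> (2 * (K * M K) + f0 <= f1)%N)
  (mark_rate : c * #|offer 2 n|%:R <= (f0./2 * f0./2)%:R)
  (link_rate : forall K, (0 < K <= K0)%N ->
     c / b K * #|offer 2 n|%:R <= (K * M K * f0)%:R)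
  (N0 : (0 < #|offer 2 n|)%N).

(** Bound for the expected remaining time with [K] missing links and [k] marks: [1 / c] per mark
    still to be made and [b j / c] for the link made when [j] are missing. That link uses up [M j]
    marks, hence the sum of the [M j]. *)
Definition link_cost K (k : nat) : R :=
  c^-1 * (\sum_(1 <= j < K.+1) (M j)%:R - k%:R + \sum_(1 <= j < K.+1) b j).

Definition mark : Type := 'I_n * ('I_n * 'I_n).
Definition centre (q : mark) := q.2.2.
Definition middle (q : mark) := q.2.1.

Definition marked (mk : seq mark) := [seq middle q | q <- mk] ++ [seq centre q | q <- mk].

Definition linking_state (w : R) H : Prop := exists us F (mk : seq mark),
  [/\ us \subset links, F \subset reserve, Good us F H & (#|us| <= K0)%N] /\
  [/\ (f1 + 3 * #|us| <= #|F|)%N, uniq (marked mk),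
      forall v, v \in us -> (count (fun q => q.1 == v) mk <= M #|us|)%N,
      forall q : mark, q \in mk -> [/\ q.1 \in us, middle q \in F, centre q \in F &
         edge s (l1 q.1) q.1 (middle q) (centre q) \in H] &
      w = link_cost #|us| (size mk)].

Lemma size_marks us (mk : seq mark) :
  (forall q, q \in mk -> q.1 \in us) ->
  size mk = (\sum_(v in us) count (fun q => q.1 == v) mk)%N.
Proof.
elim: mk => [|q mk IH] mkus; first by rewrite big1.
rewrite /= IH; last by move=> q' q'mk; apply: mkus; rewrite inE q'mk orbT.
rewrite big_split /= [X in _ = (X + _)%N](bigD1 q.1) /=; last by apply: mkus; rewrite inE eqxx.
rewrite eqxx [X in (true + X)%N]big1 // => v /andP[_ vq].
by rewrite eq_sym (negPf vq).
Qed.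

Lemma sum_M_ge K : (K * M K <= \sum_(1 <= j < K.+1) M j)%N.
Proof.
elim: K => [|K IH]; first by rewrite mul0n.
rewrite big_nat_recr //= mulSn addnC leq_add2r; apply: leq_trans IH.
by case: K => [|K]; rewrite ?mul0n // leq_mul2l M_mono ?orbT.
Qed.

Lemma linking_state_ge0 w H : linking_state w H -> 0 <= w.
Proof.
case=> us [F [mk [_ [_ _ cM mkP ->]]]].
rewrite mulr_ge0 ?invr_ge0 ?(ltW c0) // addr_ge0 //; last first.
  by rewrite big_nat_cond sumr_ge0 // => j /andP[/andP[j1 _] _]; rewrite ltW ?b0.
rewrite subr_ge0 -natr_sum ler_nat; apply: leq_trans (sum_M_ge _).
rewrite (@size_marks us mk) => [|q /mkP[]//].
by rewrite -sum_nat_const; apply: leq_sum.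
Qed.

(** If some hub has fewer than [M K] marks, an offer of two free reserve vertices gives it a new
    one; if all have [M K], the centre of a mark and a free vertex complete a link. *)
Lemma linking_step w H : linking_state w H -> Q H \/
  exists p, exists A : {set offer 2 n}, [/\ pmin <= p, p * #|offer 2 n|%:R <= #|A|%:R &
    forall U, U \in A -> exists2 a, legal_reply s U a &
      exists2 w', linking_state w' (add_round H (U, a)) & w' <= w - p^-1].
Proof.
case=> us [F [mk [[usl FR good usK] [cF umk cM mkP ->]]]].
have [us0|us0] := eqVneq us finset.set0; first by left; apply: (good_done (F := F)); rewrite -us0.
right; move: us0; rewrite -finset.card_gt0; move KE : #|us| usK cF cM => K usK cF cM K1.
have KK : (0 < K <= K0)%N by rewrite K1.
have Fc : F \subset core s n by apply: fintype.subset_trans FR reserve_core.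
have usP v : v \in us -> v \in links by apply: (fintype.subsetP usl).
pose free := F :\: [set x in marked mk].
have smk : (size mk <= K * M K)%N.
  rewrite (@size_marks us mk) => [|q /mkP[]//].
  by rewrite -KE -sum_nat_const KE; apply: leq_sum.
have cfree : (f0 <= #|free|)%N.
  have : (#|[set x in marked mk]| <= 2 * size mk)%N.
    by rewrite cardsE (leq_trans (card_size _)) // size_cat !size_map addnn mul2n.
  have := subset_leq_card (finset.subsetIr F [set x in marked mk]).
  rewrite /free cardsD; move: (room KK) smk cF; set k := (K * _)%N; set e := #|[set _ in _]|;
    set d := #|_ :&: _|; set z := size mk; set g := #|F|.
  by move: g z d e k; clear; lia.
have freeF x : x \in free -> x \in F by case/finset.setDP.
have freeN x : x \in free -> x \notin marked mk by case/finset.setDP => _; rewrite inE.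
have Fcore x : x \in F -> x \in core s n by apply: (fintype.subsetP Fc).
have FnL x v : x \in F -> v \notin reserve -> v != x.
  by move=> xF; apply: contraNneq => ->; apply: (fintype.subsetP FR).
have [/existsP[v /andP[vus vM]]|full] :=
  boolP [exists v, (v \in us) && (count (fun q => q.1 == v) mk < M K)%N].
- have half : (#|free|./2 <= #|free|)%N by rewrite -divn2 leq_div.
  (* Only offers across two halves of the free vertices are used; the centre [y] lies in [P] and the
     middle [x] outside it. *)
  have [P Pfree cP] := subset_of_card half.
  exists c; exists (crossing P (free :\: P)).
  have dP : [disjoint P & free :\: P].
    by rewrite disjoints_subset; apply/fintype.subsetP => x xP; rewrite !inE xP.
  split=> //.
    apply: le_trans mark_rate _; rewrite ler_nat; apply: leq_trans (card_crossing dP).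
    rewrite cardsDS // cP; apply: leq_mul; rewrite ?half_leq //.
    exact: leq_trans (half_leq cfree) (half_leq_sub _).
  move=> U /crossingP[y [x [yP xPf eU]]].
  have yf : y \in free by apply: (fintype.subsetP Pfree).
  have xf : x \in free by case/finset.setDP: xPf.
  have xy : x != y by apply: contraTneq xPf => ->; rewrite finset.in_setD yP.
  have [vc vr] := links_core (usP _ vus).
  have [a la addE] := reply_edge (s := s) s3 sn (l1_lt (usP _ vus)) (Fcore _ (freeF _ yf))
    (Fcore _ (freeF _ xf)) vc (FnL _ _ (freeF _ yf) vr) (FnL _ _ (freeF _ xf) vr) eU.
  exists a => //; exists (link_cost K (size mk).+1); last first.
    by rewrite /link_cost -natr1 /=; lra.
  have subH : H \subset add_round H (U, a) by rewrite addE finset.subsetUr.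
  exists us, F, ((v, (x, y)) :: mk); rewrite KE; split; split=> //.
  + exact: good_mono subH.
  + rewrite -[marked _]/((x :: [seq middle q | q <- mk]) ++ [:: y] ++ [seq centre q | q <- mk]).
    rewrite uniq_catCA /= -/(marked mk) inE negb_or eq_sym xy umk andbT.
    by rewrite !freeN.
  + move=> u uus /=; case: eqVneq => [<-|_]; first by rewrite add1n.
    by rewrite add0n cM.
  + move=> q; rewrite inE => /orP[/eqP->|/mkP[q1 q2 q3 q4]] /=; split=> //; rewrite ?freeF //.
      by rewrite addE edge_rev finset.setU11.
    exact: (fintype.subsetP subH).
have cE v : v \in us -> count (fun q => q.1 == v) mk = M K.
  move=> vus; apply/eqP; rewrite eqn_leq cM //= leqNgt; apply: contra full => vM.
  by apply/existsP; exists v; rewrite vus.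
have smkE : size mk = (K * M K)%N.
  by rewrite (@size_marks us mk) => [|q /mkP[]//]; rewrite -KE -sum_nat_const KE; apply: eq_bigr.
have uc : uniq [seq centre q | q <- mk] by move: umk; rewrite cat_uniq => /and3P[].
have um : uniq [seq middle q | q <- mk] by move: umk; rewrite cat_uniq => /and3P[].
have umc q q' : q \in mk -> q' \in mk -> middle q != centre q'.
  move=> qmk q'mk; apply/eqP => e; move: umk; rewrite cat_uniq => /and3P[_ /hasPn nc _].
  by have := nc _ (map_f centre q'mk); rewrite /= -e map_f.
pose P := [set y in [seq centre q | q <- mk]].
have cP : #|P| = (K * M K)%N by rewrite cardsE (card_uniqP uc) size_map.
have dP : [disjoint P & free].
  rewrite disjoints_subset; apply/fintype.subsetP => y; rewrite finset.in_setC => yP.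
  by apply: contraL yP => /freeN; rewrite mem_cat negb_or inE => /andP[].
have c'0 : c != 0 by rewrite gt_eqF.
have bK0 : b K != 0 by rewrite gt_eqF // b0.
exists (c / b K); exists (crossing P free); split=> //; first exact: pminb.
  apply: le_trans (link_rate KK) _; rewrite ler_nat; apply: leq_trans (card_crossing dP).
  by rewrite cP leq_mul2l cfree orbT.
move=> U /crossingP[y [z [yP zf eU]]].
move: yP; rewrite inE => /mapP[q qmk yE]; have [vus xF yF eH] := mkP _ qmk.
set v := q.1 in vus eH; set x := middle q in xF eH; rewrite -yE in yF eH.
have vl := usP _ vus; have [vc vr] := next_core vl.
have zF := freeF _ zf.
have [a la addE] := reply_edge (s := s) s3 sn (l2_lt vl) (Fcore _ yF) (Fcore _ zF) vc
  (FnL _ _ yF vr) (FnL _ _ zF vr) eU.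
exists a => //.
have subH : H \subset add_round H (U, a) by rewrite addE finset.subsetUr.
have zm q' : q' \in mk -> z != middle q' /\ z != centre q'.
  move=> q'mk; have := freeN _ zf; rewrite mem_cat negb_or => /andP[zx zy].
  by split; apply/eqP => e; [move: zx | move: zy]; rewrite e map_f.
have xyz : uniq [:: x; y; z].
  have [zx zy] := zm _ qmk; rewrite /= !inE negb_or -[y == z]eq_sym yE zy.
  by rewrite eq_sym in zx; rewrite zx umc.
pose mk' := [seq q' <- mk | q'.1 != v].
have cus : #|us :\ v| = K.-1 by move: (cardsD1 v us); rewrite vus KE add1n => ->.
have sub3 : [set x; y; z] \subset F.
  by apply/fintype.subsetP => u; rewrite !inE -orbA => /or3P[] /eqP->.
have c3 : #|[set x; y; z]| = 3%N.
  have <- : size [:: x; y; z] = 3%N by [].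
  by rewrite -(card_uniqP xyz); apply: eq_card => u; rewrite !inE orbA.
have smk' : (size mk' + M K)%N = size mk.
  rewrite size_filter -(cE _ vus) addnC -(count_predC (fun q => q.1 == v) mk).
  by congr (_ + _)%N; apply: eq_count.
exists (link_cost K.-1 (size mk')); last first.
  (* The link discards the [M K] marks of [v], and the sum of the [M j] loses its term [M K]; what
     remains is a drop by [b K / c], the inverse of the rate. *)
  rewrite /link_cost -smk' natrD -[in X in _ <= X](prednK K1) !(big_nat_recr K.-1.+1) //=.
  rewrite !(prednK K1) invf_div le_eqVlt; apply/orP; left; apply/eqP.
  by field.
exists (us :\ v), (F :\: [set x; y; z]), mk'; split; split.
- exact: fintype.subset_trans (subD1set _ _) usl.
- exact: fintype.subset_trans (finset.subsetDl _ _) FR.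
- apply: good_link (good_mono good subH) _ _ vus xF yF zF xyz _ _ => //.
    exact: (fintype.subsetP subH).
  by rewrite addE finset.setU11.
- by rewrite cus (leq_trans (leq_pred _)).
- rewrite cus cardsDS // c3; move: cF; rewrite -{1}(prednK K1); move: K.-1 #|F| => k g;
  exact: room_left.
- apply: subseq_uniq umk; apply: cat_subseq; apply: map_subseq; exact: filter_subseq.
- move=> u; rewrite finset.in_setD1 => /andP[uv uus]; rewrite cus.
  apply: leq_trans (_ : M K <= _)%N; last first.
    have K2 : (0 < K.-1)%N by rewrite -cus; apply/card_gt0P; exists u; rewrite finset.in_setD1 uv.
    by rewrite -{1}(prednK K1) M_mono.
  rewrite -(cE _ uus) count_filter; apply: sub_count => q' /=.
  by case/andP.
- move=> q'; rewrite mem_filter => /andP[q'v q'mk]; have [q1 q2 q3 q4] := mkP _ q'mk.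
  have [zx zy] := zm _ q'mk.
  have qq : q' != q by apply: contraNneq q'v => ->.
  split.
  + by rewrite finset.in_setD1 q'v.
  + rewrite finset.in_setD q2 andbT !inE !negb_or -andbA; apply/and3P; split.
    * by apply: contraNneq qq => /(uniq_map_inj um q'mk qmk) ->.
    * by rewrite yE umc.
    * by rewrite eq_sym.
  + rewrite finset.in_setD q3 andbT !inE !negb_or -andbA; apply/and3P; split.
    * by rewrite eq_sym umc.
    * by rewrite yE; apply: contraNneq qq => /(uniq_map_inj uc q'mk qmk) ->.
    * by rewrite eq_sym.
  + exact: (fintype.subsetP subH).
- by rewrite cus.
Qed.

Lemma fail_linking t H : (f1 + 3 * #|links| <= #|reserve|)%N -> (#|links| <= K0)%N ->
  Good links reserve H ->
  @fail R 2 s n Q t H <= expR (pmin / 2 * (2 * link_cost #|links| 0 - t%:R)).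
Proof.
move=> cR cL good.
apply: (fail_drift pmin0 N0 linking_state_ge0 linking_step).
by exists links, reserve, [::].
Qed.

End Linking.

(** * Completing the cycle *)

(** Each element of a cycle is replaced by a path; below, a hub is replaced by the one or two edges
    that lead to the next hub. *)
Lemma cycle_flatten (T T' : Type) (e : rel T') (hd : T -> T') (tl : T -> seq T') k :
  cycle (fun v w => path e (hd v) (tl v) && e (last (hd v) (tl v)) (hd w)) k ->
  cycle e (flatten [seq hd v :: tl v | v <- k]).
Proof.
set E := fun v w => _.
have step p v w : path E v (rcons p w) ->
    path e (hd v) (tl v ++ flatten [seq hd v :: tl v | v <- p] ++ [:: hd w]).
  elim: p v => [|u p IH] v /=; first by rewrite andbT cat_path /= andbT.
  by case/andP => /andP[pv vu] /IH pu; rewrite cat_path pv /= vu -catA.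
by case: k => [|v p] //= /step; rewrite -cats1 -catA.
Qed.

Lemma uniq_flatten_map (T T' : eqType) (g : T -> seq T') k :
  uniq k -> (forall v, v \in k -> uniq (g v)) ->
  (forall v w u, v \in k -> w \in k -> v != w -> u \in g v -> u \notin g w) ->
  uniq (flatten [seq g v | v <- k]).
Proof.
elim: k => [|v k IH] //= /andP[vk uk] ug dg; rewrite cat_uniq ug ?mem_head //=.
rewrite IH // => [|w wk|w w' u wk w'k]; last 2 first.
- by apply: ug; rewrite inE wk orbT.
- by apply: dg; rewrite inE ?wk ?w'k orbT.
rewrite andbT; apply/hasPn => u /flattenP[_ /mapP[w wk ->] uw].
apply: (dg w v) => //; rewrite ?mem_head // ?inE ?wk ?orbT //.
by apply: contraNneq vk => <-.
Qed.

Section Completion.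
Variables (s n a : nat).
Hypotheses (s3 : (3 <= s)%N) (sn : (s - 1 %| n)%N) (n0 : (0 < n)%N).
Notation graph := {set {set 'I_n}}.
Notation m := (n %/ (s - 1))%N.
Notation slots := (slots s n a).
Notation middles := (middles s n a).

Variables (D B : {set 'I_n}).
Hypotheses (D_slots : D \subset slots) (B_middles : B \subset middles).

(* The hubs in cyclic order.  A hub in [D] is joined to the next one by an edge of
   its slot, a hub in [links] by two edges. *)
Definition hubs : seq 'I_n := take (m - 4 * a).+1 (enum 'I_n) ++ enum B.

Definition links : {set 'I_n} := [set v in hubs] :\: D.

Definition free_labels : {set 'I_n} := [set v : 'I_n | (v < m)%N] :\: D.

(** The link with index [i] takes the entries [2 * i] and [2 * i + 1] of the list of labels that no
    slot in [D] uses. *)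
Definition link_label (i : bool) (v : 'I_n) : nat :=
  nth v (enum free_labels) (2 * index v (enum links) + i).

Let m_lt_n : (m - 4 * a < n)%N.
Proof.
have := core_le_n s3 sn; have : (0 < m)%N by rewrite divn_gt0; [apply: dvdn_leq | lia].
by move: (n %/ _)%N => q; lia.
Qed.

Lemma mem_take_enum k (v : 'I_n) : (v \in take k (enum 'I_n)) = (v < k)%N.
Proof. by rewrite in_take ?mem_enum // index_enum_ord. Qed.

Lemma uniq_hubs : uniq hubs.
Proof.
rewrite cat_uniq take_uniq ?enum_uniq // andbT; apply/hasPn => v; rewrite mem_enum => vB.
by have := fintype.subsetP B_middles _ vB; rewrite /= mem_take_enum !inE; lia.
Qed.

Lemma size_hubs : size hubs = ((m - 4 * a).+1 + #|B|)%N.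
Proof. by rewrite size_cat size_takel ?size_enum_ord // cardE. Qed.

Lemma slots_hubs v : v \in slots -> v \in hubs.
Proof. by rewrite inE mem_cat mem_take_enum => vm; rewrite ltnS ltnW. Qed.

Lemma card_links : (#|links| + #|D| = (m - 4 * a).+1 + #|B|)%N.
Proof.
have Dh : D \subset [set v in hubs].
  by apply/fintype.subsetP => v /(fintype.subsetP D_slots)/slots_hubs; rewrite inE.
have -> : ((m - 4 * a).+1 + #|B| = #|[set v in hubs]|)%N.
  by rewrite -size_hubs cardsE (card_uniqP uniq_hubs).
by rewrite /links cardsDS // subnK ?subset_leq_card.
Qed.

(** The list of hubs begins with [0, ..., m - 4 * a], so position and value agree there. *)
Lemma next_slot v : v \in slots -> next hubs v = ordS v.
Proof.
move=> vI; have vh := slots_hubs vI; apply: val_inj; rewrite (ordS_slot s3 sn vI).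
have vm : (v < m - 4 * a)%N by move: vI; rewrite inE.
have nthE i : (i < (m - 4 * a).+1)%N -> val (nth v hubs i) = i.
  move=> im; rewrite nth_cat size_takel ?size_enum_ord // im nth_take //.
  by apply: nth_enum_ord; apply: leq_ltn_trans m_lt_n; rewrite -ltnS.
have iv : index v hubs = v.
  have vE : nth v hubs v = v by apply: val_inj; rewrite nthE // ltnS ltnW.
  by rewrite -{1}vE index_uniq ?uniq_hubs // size_hubs; lia.
rewrite next_nth vh iv; have := nthE v.+1; have := size_hubs.
case: (hubs) => [|y p] //= sp; rewrite ltnS => /(_ vm).
by rewrite (set_nth_default y) //; lia.
Qed.

Lemma hubs_core v : v \in hubs -> v \in core s n.
Proof.
have := core_le_n s3 sn; have : (0 < m)%N by rewrite divn_gt0; [apply: dvdn_leq | lia].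
rewrite mem_cat mem_take_enum mem_enum inE; move: (fintype.subsetP B_middles v).
rewrite !inE; move: (n %/ _)%N => q; case: (v \in B) => [/(_ isT)|_]; lia.
Qed.

Hypothesis (cardD : (#|D| + 2 * #|links| = m)%N).

Lemma card_free_labels : #|free_labels| = (2 * #|links|)%N.
Proof.
rewrite /free_labels cardsDS; last first.
  by apply/fintype.subsetP => v /(fintype.subsetP D_slots); rewrite !inE; lia.
have -> : #|[set v : 'I_n | (v < m)%N]| = m.
  rewrite -[RHS]subn0 -(card_interval 0 (leq_div n (s - 1))).
  by apply: eq_card => v; rewrite !inE.
lia.
Qed.

Let label_index (i : bool) v : v \in links -> (2 * index v (enum links) + i < size (enum
  free_labels))%N.
Proof.
rewrite -cardE card_free_labels -mem_enum -index_mem -cardE => vl.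
by case: i; move: vl; lia.
Qed.

Lemma link_label_free i v : v \in links ->
  exists2 w : 'I_n, w \in free_labels & link_label i v = w.
Proof.
move=> vl; exists (nth v (enum free_labels) (2 * index v (enum links) + i)) => //.
by rewrite -mem_enum mem_nth ?label_index.
Qed.

Lemma link_label_lt i v : v \in links -> (link_label i v < m)%N.
Proof. by case/(link_label_free i) => w /finset.setDP[]; rewrite inE => wm _ ->. Qed.

Lemma link_label_inj i j v w : v \in links -> w \in links ->
  link_label i v = link_label j w -> v = w /\ i = j.
Proof.
move=> vl wl; rewrite /link_label (set_nth_default v w) ?label_index // => /val_inj/eqP.
rewrite nth_uniq ?enum_uniq ?label_index // => /eqP e.
have ij : i = j by move: e; case: (i); case: (j) => //=; lia.
split=> //; move: e; rewrite ij => /addIn/eqP; rewrite eqn_pmul2l // => /eqP e.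
have vE : nth v (enum links) (index v (enum links)) = v by rewrite nth_index ?mem_enum.
by rewrite -vE e nth_index ?mem_enum.
Qed.

Section Final.
Variables (H : graph) (Y Z : {set 'I_n}) (f x y z : 'I_n -> 'I_n).
Let triple v := [:: x v; y v; z v].
Hypotheses (f_inj : {in D &, injective f})
  (fP : forall v, v \in D -> f v \in Y /\ slot_edge s H v (f v))
  (tripleP : forall v, v \in links -> [/\ uniq (triple v), {subset triple v <= Z},
     edge s (link_label false v) v (x v) (y v) \in H &
     edge s (link_label true v) (y v) (z v) (next hubs v) \in H])
  (triple_disjoint : forall v w u, v \in links -> w \in links -> v != w ->
     u \in triple v -> u \notin triple w)
  (Y_middles : Y \subset middles :\: B) (Z_middles : Z \subset middles :\: B)
  (disjoint_YZ : [disjoint Y & Z]).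

(** Entries (hub, label, middle) contributed by [v]. A link contributes two, and its vertex [y v]
    acts as the hub of the second. *)
Let hd v := if v \in D then (v, val v, f v) else (v, link_label false v, x v).
Let tl v := if v \in D then [::] else [:: (y v, link_label true v, z v)].
Let L := flatten [seq hd v :: tl v | v <- hubs].

Let in_links v : v \in hubs -> v \notin D -> v \in links.
Proof. by move=> vh vD; rewrite finset.in_setD vD inE. Qed.

Let good_hubs := [seq v <- hubs | v \in D].
Let link_hubs := [seq v <- hubs | v \notin D].

Let mem_good v : (v \in good_hubs) = (v \in D).
Proof.
rewrite mem_filter; case: (boolP (v \in D)) => //= vD.
exact/slots_hubs/(fintype.subsetP D_slots).
Qed.

Let mem_link v : (v \in link_hubs) = (v \in links).
Proof. by rewrite mem_filter finset.in_setD inE. Qed.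

Let size_L : size L = m.
Proof.
have -> : size L = (size good_hubs + 2 * size link_hubs)%N.
  rewrite /L /good_hubs /link_hubs; elim: (hubs) => //= v k IH.
  by rewrite size_cat IH /tl; case: (v \in D) => /=; clear; lia.
rewrite -(card_uniqP (filter_uniq _ uniq_hubs)) -[size link_hubs](card_uniqP (filter_uniq _
  uniq_hubs)).
by rewrite (eq_card mem_good) (eq_card mem_link).
Qed.

Let cycle_L : cycle (fun u v => edge s u.1.2 u.1.1 u.2 v.1.1 \in H) L.
Proof.
apply: cycle_flatten; have := cycle_next uniq_hubs.
apply: (@sub_in_cycle _ (mem hubs)); last by apply/allP.
have hd1 w : (hd w).1.1 = w by rewrite /hd; case: ifP.
move=> v w vh wh /eqP <-; rewrite hd1 /hd /tl; case: ifPn => vD /=.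
  rewrite next_slot; first by case: (fP vD).
  exact: (fintype.subsetP D_slots).
by have [_ _ -> ->] := tripleP (in_links vh vD).
Qed.

Let perm_vertices : perm_eq ([seq u.1.1 | u <- L] ++ [seq u.2 | u <- L])
  (hubs ++ [seq f v | v <- good_hubs] ++ flatten [seq triple v | v <- link_hubs]).
Proof.
apply/seq.permP => p; rewrite /L /good_hubs /link_hubs; elim: (hubs) => //= v k.
rewrite [hd v]/hd [tl v]/tl; case: (v \in D) => /=;
  rewrite ?(map_cat, count_cat) /= ?(map_cat, count_cat) /=; clear; lia.
Qed.

Let perm_labels : perm_eq [seq u.1.2 | u <- L]
  ([seq val v | v <- good_hubs] ++
   flatten [seq [:: link_label false v; link_label true v] | v <- link_hubs]).
Proof.
apply/seq.permP => p; rewrite /L /good_hubs /link_hubs; elim: (hubs) => //= v k.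
rewrite [hd v]/hd [tl v]/tl; case: (v \in D) => /=;
  rewrite ?(map_cat, count_cat) /= ?(map_cat, count_cat) /=; clear; lia.
Qed.

Let f_mem u : u \in [seq f v | v <- good_hubs] -> u \in Y.
Proof. by case/mapP => v; rewrite mem_good => /fP[fY _] ->. Qed.

Let triple_mem u : u \in flatten [seq triple v | v <- link_hubs] -> u \in Z.
Proof.
by case/flattenP => _ /mapP[v vl ->]; rewrite mem_link in vl; have [_ sub _ _] := tripleP vl;
  apply: sub.
Qed.

Let hubs_middles u : u \in hubs -> u \notin middles :\: B.
Proof.
rewrite mem_cat mem_take_enum mem_enum finset.in_setD => /orP[um|->] //.
by rewrite !inE; move: um; move: (n %/ _)%N; clear; lia.
Qed.

Lemma loose_Hamilton_of_links : has_loose_Hamilton_cycle s H.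
Proof.
apply: (@loose_Hamilton_of_cycle s n s3 sn n0 H L) => //.
- rewrite (perm_uniq perm_vertices) cat_uniq uniq_hubs cat_uniq /=; apply/and4P; split.
  + apply/hasPn => u; rewrite mem_cat => /orP[/f_mem uY|/triple_mem uZ];
      apply/negP => /hubs_middles/negP; apply.
      exact: (fintype.subsetP Y_middles).
    exact: (fintype.subsetP Z_middles).
  + rewrite map_inj_in_uniq ?filter_uniq ?uniq_hubs // => v w.
    by rewrite !mem_good; apply: f_inj.
  + apply/hasPn => u /triple_mem uZ; apply/negP => /f_mem uY.
    by rewrite (disjointFr disjoint_YZ uY) in uZ.
  + apply: uniq_flatten_map => [|v|v w u]; rewrite ?mem_link.
    * by rewrite filter_uniq ?uniq_hubs.
    * by case/tripleP.
    * exact: triple_disjoint.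
- move=> u; rewrite (perm_mem perm_vertices) mem_cat.
  have mc w : w \in middles :\: B -> w \in core s n.
    by case/finset.setDP; rewrite !inE => /andP[].
  case/orP => [|]; first exact: hubs_core.
  rewrite mem_cat => /orP[/f_mem uY|/triple_mem uZ].
    by apply/mc/(fintype.subsetP Y_middles).
  by apply/mc/(fintype.subsetP Z_middles).
- rewrite (perm_uniq perm_labels) cat_uniq; apply/and3P; split.
  + by rewrite (map_inj_uniq val_inj) filter_uniq ?uniq_hubs.
  + apply/hasPn => u /flattenP[_ /mapP[v vl ->]]; rewrite mem_link in vl.
    rewrite !inE => /orP[] /eqP->;
      [have [w wf ->] := link_label_free false vl | have [w wf ->] := link_label_free true vl];
    by apply/negP => /mapP[w']; rewrite mem_good => w'D /val_inj e; move: wf; rewrite e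
      finset.in_setD w'D.
  + apply: uniq_flatten_map => [|v|v w u]; rewrite ?mem_link.
    * by rewrite filter_uniq ?uniq_hubs.
    * move=> vl; rewrite /= inE andbT; apply/eqP.
      by case/(link_label_inj vl vl).
    move=> vl wl vw; rewrite !inE.
    by move=> /orP[] /eqP->; apply/norP; split; apply/eqP => /(link_label_inj vl wl)[e _];
      rewrite e eqxx in vw.
- apply/allP => u uL; have : u.1.2 \in [seq u.1.2 | u <- L] by apply: (map_f (fun u => u.1.2)).
  rewrite (perm_mem perm_labels) mem_cat => /orP[/mapP[v]|/flattenP[_ /mapP[v vl ->]]].
    rewrite mem_good => /(fintype.subsetP D_slots); rewrite inE => vm ->.
    by apply: leq_trans vm (leq_subr _ _).
  by rewrite mem_link in vl; rewrite !inE => /orP[] /eqP->; apply: link_label_lt.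
Qed.

End Final.
End Completion.

(** * From a mixing graph through the linking phase to the cycle *)

Section AfterMixing.
Variables (s n a : nat).
Hypotheses (s3 : (3 <= s)%N) (sn : (s - 1 %| n)%N) (n0 : (0 < n)%N).
Notation graph := {set {set 'I_n}}.
Notation m := (n %/ (s - 1))%N.
Notation slots := (slots s n a).
Notation middles := (middles s n a).
Hypotheses (a3 : (3 <= a)%N) (am : (11 * a <= m)%N).

(** Near middles never enter the reserve, so those outside [B] are all available to the final
    matching; the reserve and the extra hubs come from the far ones. *)
Definition near_middles : {set 'I_n} := [set v : 'I_n | (m - 4 * a < v < m.+1)%N].
Definition far_middles : {set 'I_n} := [set v : 'I_n | (m < v < 2 * m)%N].

Lemma card_near_middles : #|near_middles| = (4 * a)%N.
Proof.
have := core_le_n s3 sn; move: am => am' mn; rewrite card_interval; move: am' mn;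
  by move: (n %/ _)%N => q; lia.
Qed.

Lemma card_far_middles : #|far_middles| = (m - 1)%N.
Proof. by rewrite card_interval ?(core_le_n s3 sn) //; move: (n %/ _)%N => q; lia. Qed.

Lemma card_slots : #|slots| = (m - 4 * a)%N.
Proof.
rewrite -[RHS]subn0 -(@card_interval n 0); first by apply: eq_card => v; rewrite !inE.
by rewrite (leq_trans (leq_subr _ _)) // leq_div.
Qed.

Lemma near_far_middles : near_middles :|: far_middles = middles.
Proof.
apply/setP => v; rewrite !inE; move: am; move: (n %/ _)%N => q aq.
apply/idP/idP; lia.
Qed.

Lemma disjoint_near_far : [disjoint near_middles & far_middles].
Proof.
by rewrite disjoints_subset; apply/fintype.subsetP => v; rewrite !inE; move: (n %/ _)%N;
  clear; lia.
Qed.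

(** The cycle has [#|D| + 2 * #|links|] edges, which is twice the number of hubs minus [#|D|]; for
    this to equal [m], the number of slots left out must be even. *)
Lemma even_superset (A : {set 'I_n}) : A \subset slots -> (#|A| <= a)%N ->
  exists (A' : {set 'I_n}) h, [/\ A \subset A', A' \subset slots, #|A'| = (2 * h)%N & (#|A'|
    <= #|A|.+1)%N].
Proof.
move=> AI Aa; have [oA|eA] := boolP (odd #|A|); last first.
  exists A, #|A|./2; split=> //.
  by have := odd_double_half #|A|; rewrite (negPf eA) add0n -mul2n.
have [j /finset.setDP[jI jA]] : exists j, j \in slots :\: A.
  by apply/card_gt0P; rewrite cardsDS // card_slots; move: am; move: (n %/ _)%N => q; lia.
exists (j |: A), (uphalf #|A|); split.
- exact: finset.subsetUr.
- by rewrite finset.subUset sub1set jI.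
- by rewrite cardsU1 jA; have := odd_double_half #|A|; rewrite oA uphalf_half oA; lia.
- by rewrite cardsU1 jA.
Qed.

(* What remains to be done once [A] and [B] are removed: [2 * h] slots become
   links and [2 * a - 1 - h] middles become hubs, which makes the number of
   edges of the cycle equal to [m]. *)
Lemma removal (e : rel 'I_n) : mixing e a slots middles ->
  exists A B D B' : {set 'I_n},
  [/\ A \subset slots, B \subset middles, B' \subset middles & B \subset B'] /\
  [/\ expanding e a (slots :\: A) (near_middles :\: B),
      expanding (transpose e) a (middles :\: B) (slots :\: A),
      D \subset slots :\: A, (#|slots :\: A| <= #|D|.+1)%N & near_middles :\: B' =
        near_middles :\: B] /\
  [/\ (#|D| + 2 * #|links s a D B'| = m)%N, (#|links s a D B'| <= 3 * a)%N,
      (#|near_middles :\: B| + #|far_middles :\: B'| = #|D| + 3 * #|links s a D B'|)%N &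
      (m - 11 * a + 3 * #|links s a D B'| <= #|far_middles :\: B'|)%N].
Proof.
move=> mix; have nearX : near_middles \subset middles by rewrite -near_far_middles
  finset.subsetUl.
have farX : far_middles \subset middles by rewrite -near_far_middles finset.subsetUr.
have a0 : (0 < a)%N by lia.
have I4 : (4 * a <= #|slots|)%N by rewrite card_slots; move: am; move: (n %/ _)%N => q; lia.
have [A [B [[AI BX Aa Ba] [expI expX]]]] : exists A B : {set 'I_n},
    [/\ A \subset slots, B \subset middles, (#|A| <= a)%N & (#|B| <= a)%N] /\
    expanding e a (slots :\: A) (near_middles :\: B) /\
    expanding (transpose e) a (middles :\: B) (slots :\: A).
  exact: (mixing_expanding mix nearX a0 I4 (eq_leq (esym card_near_middles))).
have [A' [h [AA' AI' cA' cA'1]]] := even_superset AI Aa.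
have ha : (2 * h <= a.+1)%N by rewrite -cA' (leq_trans cA'1).
(* Hubs are added until the edge count is exact; [2 * h <= a + 1], [#|B| <= a] and [3 <= a] make the
   subtraction genuine. They are far middles, so the expansion into the near ones survives. *)
have [E EsubD cE] : exists2 E : {set 'I_n}, E \subset far_middles :\: B & #|E| = (2 * a - 1 -
  h - #|B|)%N.
  apply: subset_of_card; rewrite cardsD card_far_middles.
  have := subset_leq_card (finset.subsetIr far_middles B).
  move: am; move: (n %/ _)%N #|_ :&: _|; clear -Ba ha a3 => q i; lia.
have [Efar dEB] : E \subset far_middles /\ [disjoint E & B] by move: EsubD; rewrite
  finset.subsetD => /andP[].
pose B' := B :|: E; pose D := slots :\: A'.
have cB' : #|B'| = (2 * a - 1 - h)%N.
  by rewrite cardsU_disjoint 1?disjoint_sym // cE; clear -Ba ha a3; lia.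
have cD : #|D| = (m - 4 * a - 2 * h)%N by rewrite /D cardsDS // card_slots cA'.
have BX' : B' \subset middles by rewrite finset.subUset BX (fintype.subset_trans Efar).
have nearB : near_middles :\: B' = near_middles :\: B.
  apply/setP => v; rewrite !finset.in_setD finset.in_setU; case: (boolP (v \in near_middles))
    => vn; rewrite ?andbF // !andbT.
  suff -> : v \in E = false by rewrite orbF.
  apply/negP => /(fintype.subsetP Efar) vf.
  by rewrite (disjointFr disjoint_near_far vn) in vf.
have cL : #|links s a D B'| = (2 * a + h)%N.
  have := card_links s3 sn n0 (finset.subsetDl slots A' : D \subset slots) BX'.
  rewrite cD cB'; move: am; move: (n %/ _)%N #|links _ _ _ _|; clear -ha a3 => q l; lia.
have cM : (#|near_middles :\: B| + #|far_middles :\: B'| = m + 4 * a - 1 - #|B'|)%N.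
  rewrite -nearB -cardsU_disjoint; last first.
    apply: disjointWl (finset.subsetDl _ _) (disjointWr (finset.subsetDl _ _) disjoint_near_far).
  rewrite -finset.setDUl near_far_middles cardsDS // -near_far_middles.
  rewrite (cardsU_disjoint disjoint_near_far) card_near_middles card_far_middles.
  by move: am; move: (n %/ _)%N #|B'|; clear -ha a3 => q l; lia.
exists A, B, D, B'; split; first by split=> //; apply: finset.subsetUl.
split; split=> //.
- exact: finset.setDS.
- rewrite cD cardsDS // card_slots; clear -cA'1 cA'; move: (m - 4 * a)%N => q; lia.
- by rewrite cL cD; move: am; move: (n %/ _)%N; clear -ha a3 => q; lia.
- rewrite cL; clear -ha a3; lia.
- by rewrite cM cL cD cB'; move: am; move: (n %/ _)%N; clear -ha a3 => q; lia.
- rewrite cL cardsD card_far_middles; have := subset_leq_card (finset.subsetIr far_middles B').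
  by rewrite cB'; move: am; move: (n %/ _)%N #|_ :&: _|; clear -Ba ha a3 => q i; lia.
Qed.

Variables (R : realType) (f0 : nat) (M : nat -> nat) (b : nat -> R) (c pmin : R).
Hypotheses (c0 : 0 < c) (pmin0 : 0 < pmin) (pminc : pmin <= c)
  (M_mono : forall K, (0 < K)%N -> (M K.+1 <= M K)%N)
  (b0 : forall K, (0 < K)%N -> 0 < b K)
  (pminb : forall K, (0 < K <= 3 * a)%N -> pmin <= c / b K)
  (room : forall K, (0 < K <= 3 * a)%N -> (2 * (K * M K) + f0 <= m - 11 * a)%N)
  (mark_rate : c * #|offer 2 n|%:R <= (f0./2 * f0./2)%:R)
  (link_rate : forall K, (0 < K <= 3 * a)%N ->
     c / b K * #|offer 2 n|%:R <= (K * M K * f0)%:R)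
  (N0 : (0 < #|offer 2 n|)%N).

Lemma fail_after_mixing (H0 : graph) t : mixing (slot_edge s H0) a slots middles ->
  exists2 K, (K <= 3 * a)%N &
  @fail R 2 s n (fun H => has_loose_Hamilton_cycle s H) t H0
    <= expR (pmin / 2 * (2 * link_cost M b c K 0 - t%:R)).
Proof.
move=> mix; have [A [B [D [B' [[AI BX BX' BB'] [[expI expX DI cI nearB] [cD cL cY cF]]]]]]] :=
  removal mix.
have DS : D \subset slots := fintype.subset_trans DI (finset.subsetDl _ _).
set lk := links s a D B' in cD cL cY cF.
pose reserve := far_middles :\: B'.
pose lab := link_label s a D B'.
pose nxt := next (hubs s a B').
have nearX : near_middles \subset middles by rewrite -near_far_middles finset.subsetUl.
have farX : far_middles \subset middles by rewrite -near_far_middles finset.subsetUr.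
have resX : reserve \subset middles :\: B' by apply: finset.setSD.
have resF : reserve \subset far_middles := finset.subsetDl _ _.
have midE v : v \in middles -> (m - 4 * a < v < 2 * m)%N by rewrite inE.
have hubP v : v \in hubs s a B' -> v \in core s n /\ v \notin reserve.
  move=> vh; split; first exact: (hubs_core s3 sn n0 DS BX' vh).
  apply/negP => /(fintype.subsetP resX)/finset.setDP[vm vB]; move: vh.
  rewrite mem_cat mem_take_enum mem_enum (negPf vB) orbF.
  by have /andP[v1 _] := midE _ vm; rewrite ltnS leqNgt v1.
have lkh v : v \in lk -> v \in hubs s a B' by case/finset.setDP; rewrite inE.
pose triple (x y z : 'I_n -> 'I_n) v := [:: x v; y v; z v].
(* The cardinality equation records that each link takes exactly three reserve vertices; [x], [y],
   [z] name them for the finished links. *)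
pose Good (us F : {set 'I_n}) (H : graph) := [/\ H0 \subset H, F \subset reserve &
  (#|F| + 3 * #|lk :\: us| = #|reserve|)%N] /\ exists x y z : 'I_n -> 'I_n,
  (forall v, v \in lk :\: us -> [/\ uniq (triple x y z v),
     {subset triple x y z v <= reserve :\: F},
     edge s (lab false v) v (x v) (y v) \in H & edge s (lab true v) (y v) (z v) (nxt v) \in H]) /\
  forall v w u, v \in lk :\: us -> w \in lk :\: us -> v != w ->
     u \in triple x y z v -> u \notin triple x y z w.
exists #|lk| => //.
apply: (@fail_linking R s n s3 sn lk reserve nxt (lab false) (lab true) _ _ _ _ _ Good _ _ _ _
   (3 * a)%N f0 (m - 11 * a)%N M b c pmin) => //.
- apply: fintype.subset_trans (fintype.subset_trans resX (finset.subsetDl _ _)) _.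
  by apply/fintype.subsetP => v; rewrite !inE => /andP[].
- by move=> v /lkh/hubP.
- by move=> v /lkh vh; apply: hubP; rewrite mem_next.
- by move=> v vl; apply: (link_label_lt s3 sn n0 DS BX' cD).
- by move=> v vl; apply: (link_label_lt s3 sn n0 DS BX' cD).
- move=> us F H H' [[HH FR cF'] [x [y [z [tP dP]]]]] HH'; split.
    by split=> //; apply: fintype.subset_trans HH'.
  exists x, y, z; split=> // v /tP[t1 t2 t3 t4]; split=> //; exact: (fintype.subsetP HH').
- move=> us F H v x y z [[HH FR cF'] [x' [y' [z' [tP dP]]]]] usl _ vus xF yF zF xyz e1 e2.
  have vl : v \in lk by apply: (fintype.subsetP usl).
  have lkE : lk :\: (us :\ v) = v |: (lk :\: us).
    apply/setP => u; rewrite finset.in_setU1 2![u \in lk :\: _]finset.in_setD finset.in_setD1.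
    by case: eqVneq => [->|_]; rewrite /= ?vl.
  have inF u : u \in [:: x; y; z] -> u \in F by rewrite !inE => /or3P[] /eqP->.
  have set3E u : (u \in [set x; y; z]) = (u \in [:: x; y; z]) by rewrite !inE orbA.
  have c3 : #|[set x; y; z]| = 3%N.
    by rewrite -[RHS]/(size [:: x; y; z]) -(card_uniqP xyz); apply: eq_card.
  have sub3 : [set x; y; z] \subset F by apply/fintype.subsetP => u; rewrite set3E; apply: inF.
  have F3 := subset_leq_card sub3.
  have lkN u : u \in lk :\: us -> u != v.
    by case/finset.setDP => _; apply: contraNneq => ->.
  split.
    split=> //; first exact: fintype.subset_trans (finset.subsetDl _ _) FR.
    rewrite lkE cardsU1 finset.in_setD vus /= cardsDS // c3; move: F3 cF'; rewrite c3.
    by move: #|F| #|lk :\: us| #|reserve|; clear; lia.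
  pose new (old : 'I_n -> 'I_n) w u := if u == v then w else old u.
  exists (new x' x), (new y' y), (new z' z).
  have newv : triple (new x' x) (new y' y) (new z' z) v = [:: x; y; z] by rewrite /triple
    /new eqxx.
  have newN u : u \in lk :\: us -> triple (new x' x) (new y' y) (new z' z) u = triple x' y' z' u.
    by move=> /lkN uv; rewrite /triple /new (negPf uv).
  rewrite lkE; split=> [u /finset.setU1P[->|ul]|u w i /finset.setU1P[->|ul]
    /finset.setU1P[->|wl]].
  + rewrite newv /new eqxx; split=> // i i3; rewrite finset.in_setD (fintype.subsetP FR) ?inF
    // andbT.
    by rewrite finset.in_setD set3E i3.
  + have [t1 t2 t3 t4] := tP _ ul; rewrite newN // /new (negPf (lkN _ ul)); split=> // i /t2.
    by case/finset.setDP => iR iF; apply/finset.setDP; split=> //; apply: contra iF =>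
      /finset.setDP[].
  + by rewrite eqxx.
  + rewrite newv newN // => _ /inF iF; apply/negP => it; have [_ sub _ _] := tP _ wl.
    by have /finset.setDP[_ /negP] := sub _ it; apply.
  + rewrite newv newN // => _ it; apply/negP => /inF iF; have [_ sub _ _] := tP _ ul.
    by have /finset.setDP[_ /negP] := sub _ it; apply.
  + by rewrite !newN //; apply: dP.
- move=> F H [[HH FR cF'] [x [y [z [tP dP]]]]]; rewrite finset.setD0 in cF' tP dP.
  have FX := fintype.subset_trans FR resX.
  have dYF : [disjoint near_middles :\: B & F].
    apply: disjointWl (finset.subsetDl _ _) (disjointWr FR _).
    exact: (disjointWr resF disjoint_near_far).
  have [f [finj fP]] : exists f : 'I_n -> 'I_n, {in D &, injective f} /\
      forall j, j \in D -> f j \in (near_middles :\: B) :|: F /\ slot_edge s H0 j (f j).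
    apply: (expanding_matching mix _ (finset.subsetDl _ _) (finset.subsetDl _ _) expI expX DI cI).
    * by clear -a3; lia.
    * exact: finset.subsetUl.
    * rewrite finset.subUset finset.setSD // (fintype.subset_trans FX) //.
      exact: finset.setDS.
    * rewrite cardsU_disjoint //; move: cY cF'; rewrite -/reserve.
      by move: #|near_middles :\: B| #|F| #|reserve| #|D| #|lk|; clear; lia.
  apply: (loose_Hamilton_of_links s3 sn n0 DS BX' cD
    (Y := (near_middles :\: B) :|: F) (Z := reserve :\: F) finj _ tP dP).
  + by move=> v /fP[fY fe]; split=> //; apply: (fintype.subsetP HH).
  + by rewrite finset.subUset FX andbT -nearB finset.setSD.
  + exact: fintype.subset_trans (finset.subsetDl _ _) resX.
  + rewrite disjoints_subset finset.subUset -!disjoints_subset; apply/andP; split.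
      apply: disjointWl (finset.subsetDl _ _) (disjointWr (finset.subsetDl _ _) _).
      exact: (disjointWr resF disjoint_near_far).
    by rewrite disjoints_subset; apply/fintype.subsetP => v vF; rewrite !inE vF.
- split; first by split=> //; rewrite finset.setDv cards0 muln0 addn0.
  by exists id, id, id; split=> [v|v w u]; rewrite finset.setDv inE.
Qed.

End AfterMixing.

(** * Rates *)

Section Rates.
Variables (R : realType) (m : nat).
Hypothesis m1 : (0 < m)%N.

(* With [sqrt (m / K)] marks for each of [K] missing links, creating the marks of
   one link and waiting for a link both take time of order [sqrt (m / K)]. *)
Definition delay (K : nat) : R := Num.sqrt (m%:R / K%:R).
Definition quota (K : nat) : nat := (Num.truncn (delay K)).+1.

Lemma delay_ge0 K : 0 <= delay K. Proof. exact: sqrtr_ge0. Qed.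

Lemma delay_gt0 K : (0 < K)%N -> 0 < delay K.
Proof. by move=> K1; rewrite sqrtr_gt0 divr_gt0 ?ltr0n. Qed.

Lemma delay_sqr K : (0 < K)%N -> K%:R * delay K ^+ 2 = m%:R.
Proof.
move=> K1; rewrite sqr_sqrtr ?divr_ge0 ?ler0n // mulrCA divff ?mulr1 //.
by rewrite pnatr_eq0 -lt0n.
Qed.

Lemma quota_ge K : delay K <= (quota K)%:R.
Proof. by have /andP[_ /ltW] := truncn_itv (delay_ge0 K). Qed.

Lemma quota_le K : (quota K)%:R <= delay K + 1.
Proof. by rewrite /quota -natr1 lerD2r truncn_le delay_ge0. Qed.

Lemma quota_mono K : (0 < K)%N -> (quota K.+1 <= quota K)%N.
Proof.
move=> K1; rewrite ltnS le_truncn // ler_sqrt ?divr_ge0 ?ler0n //.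
by rewrite ler_wpM2l ?ler0n // lef_pV2 ?posrE ?ltr0n // ler_nat.
Qed.

(** Telescoping: for the square roots [A] and [B] of [m * K.+1] and [m * K], [delay K.+1] is
    [(A ^+ 2 - B ^+ 2) / A], at most [2 * (A - B)]. *)
Lemma sum_delay K : \sum_(1 <= j < K.+1) delay j <= 2 * Num.sqrt (m%:R * K%:R).
Proof.
elim: K => [|K IH]; first by rewrite big_geq // mulr0 sqrtr0 mulr0.
rewrite big_nat_recr //=; apply: le_trans (lerD IH (lexx _)) _.
set B := Num.sqrt (m%:R * K%:R); set A := Num.sqrt (m%:R * K.+1%:R).
have B0 : 0 <= B by apply: sqrtr_ge0.
have A0 : 0 < A by rewrite sqrtr_gt0 mulr_gt0 ?ltr0n.
have BE : B ^+ 2 = m%:R * K%:R by rewrite sqr_sqrtr // mulr_ge0 ?ler0n.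
have AE : A ^+ 2 = m%:R * K.+1%:R by rewrite sqr_sqrtr // mulr_ge0 ?ler0n.
have K1 : K.+1%:R != 0 :> R by rewrite pnatr_eq0.
have dE : delay K.+1 = m%:R / A.
  apply/eqP; rewrite -(eqrXn2 (n := 2)) ?delay_ge0 ?divr_ge0 ?ler0n ?(ltW A0) //.
  rewrite sqr_sqrtr ?divr_ge0 ?ler0n // expr_div_n AE expr2 -mulf_div.
  by rewrite divff ?mul1r // pnatr_eq0 -lt0n.
have BA : B <= A.
  by rewrite -(ler_pXn2r (n := 2)) ?nnegrE ?(ltW A0) // BE AE ler_wpM2l ?ler0n // ler_nat.
rewrite dE -lerBrDl ler_pdivrMr //.
have -> : m%:R = A ^+ 2 - B ^+ 2 by rewrite AE BE -natr1; ring.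
by nra.
Qed.

(** The delays sum to at most [2 * m]; the quotas add at most [1] each by rounding, hence sum to at
    most [3 * m]. *)
Lemma link_cost_le (c : R) K : 0 < c -> (K <= m)%N ->
  link_cost quota delay c K 0 <= c^-1 * (5 * m%:R).
Proof.
move=> c0 Km; rewrite /link_cost ler_wpM2l ?invr_ge0 ?(ltW c0) // subr0.
have sqm : Num.sqrt (m%:R * K%:R) <= m%:R :> R.
  rewrite -[leRHS](ger0_norm (ler0n _ _)) -sqrtr_sqr ler_sqrt ?exprn_ge0 ?ler0n //.
  by rewrite expr2 ler_wpM2l ?ler0n // ler_nat.
have := sum_delay K; set S := \sum_(_ <= _ < _) delay _ => HS.
have : \sum_(1 <= j < K.+1) (quota j)%:R <= S + K%:R :> R.
  apply: (@le_trans _ _ (\sum_(1 <= j < K.+1) (delay j + 1))).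
    by apply: ler_sum => j _; apply: quota_le.
  by rewrite big_split /= sumr_const_nat subSS subn0.
have : K%:R <= m%:R :> R by rewrite ler_nat.
lra.
Qed.

End Rates.

(** * Constants and the total failure probability *)

Section TotalFailure.
Variables (R : realType) (s : nat).
Hypothesis s3 : (3 <= s)%N.

Let sq : R := s%:R ^+ 2.
(** There are at most [sq * m ^+ 2 / 2] offers, so [(m / 16) ^+ 2] of them have proportion at least
    [c], and [(m / 200) ^+ 2] at least [p]. Half of [m %/ 4] free vertices number at least [m / 16],
    and [a >= m / 200]. *)
Let c : R := 2 / (16 ^+ 2 * sq).
Let p : R := 2 / (200 ^+ 2 * sq).

Let sq0 : 0 < sq. Proof. by rewrite exprn_gt0 // ltr0n; lia. Qed.
Let c0 : 0 < c. Proof. by apply: divr_gt0; rewrite ?ltr0n //; apply: mulr_gt0 sq0; rewrite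
  exprn_gt0 ?ltr0n. Qed.
Let p0 : 0 < p. Proof. by apply: divr_gt0; rewrite ?ltr0n //; apply: mulr_gt0 sq0; rewrite
  exprn_gt0 ?ltr0n. Qed.

Section FixedSize.
Variable n : nat.
Notation m := (n %/ (s - 1))%N.
Hypotheses (sn : (s - 1 %| n)%N) (m300 : (300 <= m)%N).

Let mR : R := m%:R.
Let a := (m %/ 100)%N.

Lemma card_offer_le : #|offer 2 n|%:R <= sq * mR ^+ 2 / 2 :> R.
Proof.
rewrite ler_pdivlMr // card_offer bin2 -natrM.
have nE : n%:R <= s%:R * mR :> R.
  by rewrite -natrM ler_nat -{1}(divnK sn) mulnC leq_mul2r leq_subr orbT.
apply: (@le_trans _ _ (n%:R ^+ 2)); last by rewrite /sq -exprMn lerXn2r ?nnegrE ?mulr_ge0 ?ler0n.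
rewrite -natrX ler_nat muln2; apply: leq_trans (_ : n * n.-1 <= _)%N.
  by rewrite -[leqRHS]odd_double_half leq_addl.
by rewrite expnS expn1 leq_mul2l leq_pred orbT.
Qed.

Lemma a_bounds : (3 <= a)%N /\ (100 * a <= m)%N /\ (m <= 200 * a)%N.
Proof.
rewrite /a; move: m300; move: (n %/ _)%N; clear => q q300.
by have := divn_eq q 100; have := ltn_pmod q (isT : 0 < 100)%N; lia.
Qed.

Let a3 : (3 <= a)%N. Proof. by case: a_bounds. Qed.
Let a_le : (100 * a <= m)%N. Proof. by case: a_bounds => _ []. Qed.
Let m_le : (m <= 200 * a)%N. Proof. by case: a_bounds => _ []. Qed.

Let m0 : (0 < m)%N. Proof. exact: leq_trans m300. Qed.
Let n0 : (0 < n)%N. Proof. exact: leq_trans (leq_div n (s - 1)). Qed.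
Let a11 : (11 * a <= m)%N. Proof. by apply: leq_trans a_le; rewrite leq_mul2r orbT. Qed.

Let N0 : (0 < #|offer 2 n|)%N.
Proof. by rewrite card_offer bin_gt0; apply: leq_trans (leq_div n (s - 1)); apply: leq_trans
  m300. Qed.

Let root := Num.sqrt mR.

Let root_sqr : root ^+ 2 = mR. Proof. by rewrite sqr_sqrtr ?ler0n. Qed.

Let root1 : 1 <= root.
Proof. by rewrite -[leLHS]sqrtr1 ler_sqrt ?ler0n // ler1n. Qed.

Lemma quarter_bounds : (4 * (m %/ 4) <= m)%N /\ (m <= 16 * (m %/ 4)./2)%N /\ (m <= 8 * (m %/
  4))%N.
Proof.
move: m300; move: (n %/ _)%N; clear => q q300.
by have := divn_eq q 4; have := ltn_pmod q (isT : 0 < 4)%N; lia.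
Qed.

Lemma small_links K : (0 < K <= 3 * a)%N -> (100 * K <= 3 * m)%N.
Proof. by case/andP => _ K3; move: a_le K3; move: (n %/ _)%N a; clear; lia. Qed.

(** From [100 * K <= 3 * m] the delay is at least [5], so [K * delay K], which is [m / delay K], is
    at most [m / 5]; rounding adds at most [K]. *)
Lemma quota_sum_le K : (0 < K <= 3 * a)%N -> (K * quota R m K)%:R <= mR / 5 + 3 * mR / 100.
Proof.
move=> KP; have K1 : (0 < K)%N by case/andP: KP.
have K100 : 100 * K%:R <= 3 * mR by rewrite -!natrM ler_nat; apply: small_links.
have K0 : 0 < K%:R :> R by rewrite ltr0n.
have d0 := delay_gt0 R m0 K1; have dE := delay_sqr R m K1; have qd := quota_le R m K.
have d5 : 5 <= delay R m K.
  rewrite leNgt; apply/negP => d5; have : K%:R * delay R m K ^+ 2 < K%:R * 5 ^+ 2.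
    by rewrite ltr_pM2l // ltrXn2r // ltW.
  by rewrite dE -/mR; lra.
have Kd : K%:R * delay R m K * 5 <= mR by rewrite /mR -dE expr2 mulrA ler_wpM2l // mulr_ge0 ?ltW.
rewrite natrM; apply: (@le_trans _ _ (K%:R * (delay R m K + 1))).
  by rewrite ler_wpM2l // ltW.
by rewrite mulrDr mulr1; lra.
Qed.

Lemma expRN_le_inv (x : R) : 0 < x -> expR (- x) <= x^-1.
Proof.
move=> x0; rewrite expRN lef_pV2 ?posrE ?expR_gt0 //.
by apply: le_trans (expR_ge1Dx x); rewrite lerDr.
Qed.

Lemma fail_linking_phase t H : mixing (slot_edge s H) a (slots s n a) (middles s n a) ->
  11 * mR / c <= t%:R ->
  @fail R 2 s n (fun H => has_loose_Hamilton_cycle s H) t H <= 2 / root.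
Proof.
move=> mix ht; have r0 : 0 < root by apply: lt_le_trans root1.
have [f4 [f16 f8]] := quarter_bounds; have Nle := card_offer_le.
have cN : c * #|offer 2 n|%:R <= mR ^+ 2 / 16 ^+ 2.
  apply: le_trans (_ : c * (sq * mR ^+ 2 / 2) <= _); first by rewrite ler_wpM2l ?(ltW c0).
  rewrite /c le_eqVlt; apply/orP; left; apply/eqP; field.
  by rewrite gt_eqF.
have f16R : mR / 16 <= (m %/ 4)./2%:R by rewrite ler_pdivrMr // -natrM ler_nat mulnC.
have f8R : mR / 8 <= (m %/ 4)%:R by rewrite ler_pdivrMr // -natrM ler_nat mulnC.
(* A quarter of [m] is kept free. The least rate is [c / root], because [delay K <= root], with
   equality for [K = 1]. *)
have [|||||||||K K3] := @fail_after_mixing s n a s3 sn n0 a3 a11 R (m %/ 4)%N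
  (quota R m) (delay R m) c (c / root) _ _ _ _ _ _ _ _ _ N0 H t mix.
- exact: c0.
- exact: divr_gt0.
- by rewrite ler_pdivrMr // ler_peMr // ltW.
- by move=> K K1; apply: quota_mono.
- by move=> K K1; apply: delay_gt0.
- move=> K /andP[K1 _]; rewrite ler_wpM2l ?(ltW c0) // lef_pV2 ?posrE ?delay_gt0 //.
  rewrite ler_sqrt ?ler0n // ler_pdivrMr ?ltr0n // ler_peMr ?ler0n // ler1n.
  exact: K1.
- move=> K KP; rewrite -(leq_add2l (11 * a)) subnKC // -(ler_nat R) !natrD.
  have := quota_sum_le KP.
  have : 11 * a%:R <= 11 * mR / 100 by have : 100 * a%:R <= mR; [rewrite -natrM ler_nat | lra].
  have : 4 * (m %/ 4)%:R <= mR by rewrite -natrM ler_nat.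
  by rewrite !natrM -/mR; have := ler0n R m; rewrite -/mR; lra.
- apply: le_trans cN _; rewrite natrM -expr2 -expr_div_n lerXn2r ?nnegrE //.
  by rewrite divr_ge0 ?ler0n.
- move=> K KP; have K1 : (0 < K)%N by case/andP: KP.
  have d0 := delay_gt0 R m0 K1; have dE := delay_sqr R m K1.
  rewrite mulrAC ler_pdivrMr //; apply: le_trans cN _.
  apply: (@le_trans _ _ (K%:R * delay R m K * (mR / 8) * delay R m K)).
    have -> : K%:R * delay R m K * (mR / 8) * delay R m K = mR ^+ 2 / 8.
      by rewrite [in RHS]expr2 -[X in X * _ / 8]dE; ring.
    by rewrite ler_wpM2l ?exprn_ge0 ?ler0n // lef_pV2 ?posrE //; lra.
  rewrite ler_wpM2r ?(ltW d0) // !natrM ler_pM ?mulr_ge0 ?divr_ge0 ?ler0n ?(ltW d0) //.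
  by rewrite ler_wpM2l ?ler0n ?quota_ge.
move=> Hle; apply: le_trans Hle _.
apply: (@le_trans _ _ (expR (- (root / 2)))); last first.
  by apply: le_trans (expRN_le_inv _) _; rewrite ?divr_gt0 // invf_div.
rewrite ler_expR.
have lc : link_cost (quota R m) (delay R m) c K 0 <= c^-1 * (5 * mR).
  apply: link_cost_le => //; apply: leq_trans K3 _.
  by apply: leq_trans a_le; rewrite leq_mul2r orbT.
(* The available [11 * m / c] rounds exceed twice the cost bound [5 * m / c] by [m / c], which
   yields the exponent [- root / 2]. *)
have h : 2 * link_cost (quota R m) (delay R m) c K 0 - t%:R <= - (mR / c).
  have -> : - (mR / c) = 2 * (c^-1 * (5 * mR)) - 11 * mR / c by field; rewrite gt_eqF.
  by lra.
apply: le_trans (_ : c / root / 2 * - (mR / c) <= _).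
  apply: ler_wpM2l h; exact: divr_ge0 (divr_ge0 (ltW c0) (ltW r0)) (ler0n _ _).
rewrite -root_sqr le_eqVlt; apply/orP; left; apply/eqP; field.
by rewrite !gt_eqF.
Qed.

(** The union bound costs [4 ^ n], at most [exp (2 * n)]; against [exp (- p * t)] with
    [p * t >= 3 * n] this leaves [exp (- n)]. *)
Lemma fail_slot_phase t : 3 * n%:R <= p * t%:R ->
  @fail R 2 s n (fun H => mixing (slot_edge s H) a (slots s n a) (middles s n a)) t finset.set0
    <= root^-1.
Proof.
move=> ht; have r0 : 0 < root by apply: lt_le_trans root1.
have sq1 : 1 <= sq by rewrite /sq -natrX ler1n expn_gt0 (leq_trans _ s3).
have p1 : p <= 1.
  have q0 : 0 < 200 ^+ 2 * sq by apply: mulr_gt0 sq0; rewrite exprn_gt0 ?ltr0n.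
  by rewrite /p ler_pdivrMr // mul1r; lra.
apply: le_trans (@fail_mixing R s n a s3 sn p t _ _) _.
- by rewrite (ltW p0).
- apply: (@le_trans _ _ (p * (sq * mR ^+ 2 / 2))); first by rewrite ler_wpM2l ?(ltW p0)
  ?card_offer_le.
  have -> : p * (sq * mR ^+ 2 / 2) = (mR / 200) ^+ 2 by rewrite /p; field; rewrite gt_eqF.
  rewrite natrM -expr2 lerXn2r ?nnegrE ?divr_ge0 ?ler0n //.
  by rewrite ler_pdivrMr ?ltr0n // mulrC -natrM ler_nat.
apply: (@le_trans _ _ (expR (- n%:R))); last first.
  apply: le_trans (expRN_le_inv _) _; rewrite ?ltr0n // lef_pV2 ?posrE ?ltr0n //.
  apply: le_trans (_ : mR <= _); last by rewrite ler_nat leq_div.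
  by rewrite -root_sqr expr2 ler_peMr // ltW.
have e2 : 4 <= expR 2 :> R.
  have -> : 2 = 1 + 1 :> R by lra.
  have := expR_ge1Dx (1 : R); rewrite expRD; nra.
apply: (@le_trans _ _ (expR (- p) ^+ t * expR 2 ^+ n)).
  apply: ler_pM; rewrite ?exprn_ge0 ?subr_ge0 //.
    by rewrite lerXn2r ?nnegrE ?subr_ge0 ?expR_ge0 // expR_ge1Dx.
  by rewrite lerXn2r ?nnegrE ?expR_ge0.
rewrite -!expRM_natl -expRD ler_expR; lra.
Qed.

Lemma fail_total t1 t2 : 3 * n%:R <= p * t1%:R -> 11 * mR / c <= t2%:R ->
  @fail R 2 s n (fun H => has_loose_Hamilton_cycle s H) (t1 + t2) finset.set0 <= 3 / root.
Proof.
move=> h1 h2; have r0 : 0 < root by apply: lt_le_trans root1.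
apply: le_trans (fail_trans (Q1 := fun H => mixing (slot_edge s H) a (slots s n a) (middles s
  n a))
  (e2 := 2 / root) _ _ _ _) _.
- by rewrite divr_ge0 // ltW.
- by move=> H mix; apply: fail_linking_phase.
have := fail_slot_phase h1; set x := fail _ _ _ _ _ _; lra.
Qed.

End FixedSize.

Lemma fail_linear_time : exists C : nat, forall n, (s - 1 %| n)%N -> (300 <= n %/ (s - 1))%N ->
  @fail R 2 s n (fun H => has_loose_Hamilton_cycle s H) (C * n) finset.set0
    <= 3 / Num.sqrt (n %/ (s - 1))%:R.
Proof.
(* Both constants depend on [s] alone; [C1 * n] rounds serve the slot phase and [C2 * n] the linking
   phase, as [m <= n]. *)
pose C1 := (Num.truncn (3 / p)).+1; pose C2 := (Num.truncn (11 / c)).+1.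
have hC1 : 3 / p <= C1%:R.
  by have /andP[_ /ltW] := truncn_itv (ltW (divr_gt0 (ltr0n R 3) p0)).
have hC2 : 11 / c <= C2%:R.
  by have /andP[_ /ltW] := truncn_itv (ltW (divr_gt0 (ltr0n R 11) c0)).
exists (C1 + C2)%N => n sn m300; rewrite mulnDl; apply: fail_total => //.
  rewrite natrM mulrA ler_wpM2r ?ler0n // mulrC.
  by rewrite -ler_pdivrMr.
rewrite mulrAC natrM; apply: ler_pM => //; last by rewrite ler_nat leq_div.
by rewrite divr_ge0 ?ler0n ?(ltW c0).
Qed.

End TotalFailure.

(** * Passage to the limit *)

Import numFieldNormedType.Exports.

Local Open Scope classical_set_scope.
Local Open Scope ring_scope.

Theorem theorem4 (R : realType) (s r : nat) (hs : (3 <= s)%N)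
    (hr : r = 1%N \/ r = 2%N) :
  exists (C : nat) (sigma : forall n : nat, strategy r s n),
    prob_loose_Hamilton R (sigma n) (C * n)%N
      @[n --> within [set n : nat | (s - 1 %| n)%N] \oo] --> (1 : R).
Proof.
have [C HC] := fail_linear_time R hs.
pose Q n (H : {set {set 'I_n}}) : Prop := has_loose_Hamilton_cycle s H.
exists C, (fun n => optimal R r s (Q n) (C * n)).
apply/cvgrPdist_le => e e0; rewrite near_withinE.
(* The second bound makes [3 / sqrt m] at most [e]; the first is the size from which the failure
   bound holds. *)
pose M := maxn 300 (Num.truncn ((3 / e) ^+ 2)).+1.
have := nbhs_infty_ge (M * (s - 1)); apply: filterS => n Mn sn.
have s1 : (0 < s - 1)%N by rewrite subn_gt0 (leq_trans _ hs).
have mM : (M <= n %/ (s - 1))%N by rewrite leq_divRL.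
have m300 : (300 <= n %/ (s - 1))%N by apply: leq_trans mM; apply: leq_maxl.
have n2 : (2 <= n)%N by apply: leq_trans (leq_div n (s - 1)); apply: leq_trans m300.
have N0 : (0 < #|offer r n|)%N.
  by rewrite card_offer bin_gt0; case: hr => ->; rewrite ?(ltnW n2).
rewrite prob_optimal // opprB addrCA subrr addr0 ger0_norm ?fail_ge0 //.
have fail_r2 : @fail R r s n (Q n) (C * n) finset.set0 <= @fail R 2 s n (Q n) (C * n) finset.set0.
  by case: hr => -> //; apply: fail_one_offer; rewrite // (leq_trans _ hs).
apply: le_trans (le_trans fail_r2 (HC n sn m300)) _.
set m := (n %/ (s - 1))%N in mM *.
have m0 : 0 < m%:R :> R by rewrite ltr0n; apply: leq_trans m300.
rewrite ler_pdivrMr ?sqrtr_gt0 // mulrC -ler_pdivrMr //.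
rewrite -[leLHS]ger0_norm ?divr_ge0 ?ler0n ?(ltW e0) // -sqrtr_sqr ler_sqrt ?(ltW m0) //.
have /andP[_ /ltW] := truncn_itv (exprn_ge0 2 (divr_ge0 (ler0n R 3) (ltW e0))).
move=> /le_trans; apply; rewrite ler_nat; apply: leq_trans mM; exact: leq_maxr.
Qed.
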